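(* If $q$ is even and fixed, then, for each choice of sign in $\Omega^{\pm}$, $$\lim_{m\to\infty}\frac{i(\Omega^{\pm}(4m,q))}{q^{(2m)^2}}=\frac12\left(\prod_{i\ge 1}(1+1/q^{2i-1})+\prod_{i\ge 1}(1-1/q^{2i-1})\right),$$ and $$\lim_{m\to\infty}\frac{i(\Omega^{\pm}(4m+2,q))}{q^{(2m+1)^2}}=\frac12\left(\prod_{i\ge 1}(1+1/q^{2i-1})-\prod_{i\ge 1}(1-1/q^{2i-1})\right).$$
   Context: $q$ is a power of $2$. $\mathrm{O}^{+}(2n,q)$ is the isometry group of the quadratic form $x_1x_{1+n}+x_2x_{2+n}+\cdots+x_nx_{2n}$ on $\mathbb{F}_q^{2n}$, and $\mathrm{O}^{-}(2n,q)$ is the isometry group of a form in the other equivalence class of non-defective quadratic forms on $\mathbb{F}_q^{2n}$ (Witt index $n-1$). $\Omega^{\pm}(2n,q)$ is the derived subgroup of $\mathrm{O}^{\pm}(2n,q)$; for $n\ge 3$ it has index $2$ and consists of the $g\in\mathrm{O}^{\pm}(2n,q)$ with $\mathrm{rank}(1+g)$ even. $i(X)$ denotes the number of $g\in X$ with $g^2=1$ (the identity is counted). *)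

(* Defs.v *)
From HB Require Import structures.
From mathcomp Require Import all_boot all_order all_algebra all_fingroup all_solvable.
Set Warnings "-notation-overridden,-notation-incompatible-prefix".
From mathcomp Require Import all_classical all_reals all_analysis.

Set Implicit Arguments.
Unset Strict Implicit.
Unset Printing Implicit Defensive.

Import GRing.Theory numFieldNormedType.Exports.
Local Open Scope ring_scope.

Definition polar_form (F : fieldType) (N : nat) (Q : 'rV[F]_N -> F)
    (u v : 'rV[F]_N) : F := Q (u + v) - Q u - Q v.

Definition is_quadratic_form (F : fieldType) (N : nat)
    (Q : 'rV[F]_N -> F) : Prop :=
  [/\ forall (a : F) (v : 'rV[F]_N), Q (a *: v) = a ^+ 2 * Q v,
      forall u : 'rV[F]_N, scalar (polar_form Q u)
    & forall v : 'rV[F]_N, scalar (polar_form Q ^~ v)].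

Definition non_defective (F : fieldType) (N : nat) (Q : 'rV[F]_N -> F) : Prop :=
  forall u : 'rV[F]_N, (forall v : 'rV[F]_N, polar_form Q u v = 0) -> u = 0.

Definition equivalent_forms (F : fieldType) (N : nat)
    (Q1 Q2 : 'rV[F]_N -> F) : Prop :=
  exists2 A : 'M[F]_N, A \in unitmx & forall v : 'rV[F]_N, Q2 (v *m A) = Q1 v.

Definition plus_form (F : fieldType) (n : nat) (x : 'rV[F]_(n + n)) : F :=
  \sum_(i < n) x 0 (lshift n i) * x 0 (rshift n i).

(* Over a finite field of characteristic 2 there are exactly two equivalence
   classes of non-defective quadratic forms in dimension 2n > 0, so the second
   one is the complement of the class of plus_form.  There is no such form in
   dimension 0. *)
Definition is_minus_form (F : fieldType) (n : nat)
    (Q : 'rV[F]_(n + n) -> F) : Prop :=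
  [/\ is_quadratic_form Q, non_defective Q
    & ~ equivalent_forms Q (@plus_form F n)].

(* The sign s is true for O^+ and false for O^-. *)
Definition form_of_sign (s : bool) (F : fieldType) (n : nat)
    (Q : 'rV[F]_(n + n) -> F) : Prop :=
  if s then Q =1 @plus_form F n else is_minus_form Q.

(* Linear isometries are taken as permutations of the finite set F^N, rather
   than as elements of {'GL_N[F]}, so that the dimension N = 0 needs no special
   treatment ({'GL_0[F]} consists of 1 x 1 matrices). *)
Definition isometry (F : finFieldType) (N : nat) (Q : 'rV[F]_N -> F) :
    {set {perm 'rV[F]_N}} :=
  [set g : {perm 'rV[F]_N} |
     [forall a : F, forall u : 'rV[F]_N, forall v : 'rV[F]_N,
        g (a *: u + v) == a *: g u + g v]
     && [forall v : 'rV[F]_N, Q (g v) == Q v]].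

Lemma isometryP (F : finFieldType) (N : nat) (Q : 'rV[F]_N -> F)
    (g : {perm 'rV[F]_N}) :
  reflect (linear g /\ forall v, Q (g v) = Q v) (g \in isometry Q).
Proof.
rewrite inE; apply: (iffP andP) => [[lin isom]|[lin isom]]; split.
- move=> a u v.
  by move/forallP/(_ a)/forallP/(_ u)/forallP/(_ v)/eqP: lin.
- by move=> v; move/forallP/(_ v)/eqP: isom.
- apply/forallP=> a; apply/forallP=> u; apply/forallP=> v.
  by apply/eqP; exact: lin.
- by apply/forallP=> v; apply/eqP; exact: isom.
Qed.

Lemma isometry_group_set (F : finFieldType) (N : nat) (Q : 'rV[F]_N -> F) :
  group_set (isometry Q).
Proof.
apply/group_setP; split=> [|g h /isometryP[lg ig] /isometryP[lh ih]].
  by apply/isometryP; split=> [a u v|v]; rewrite !perm1.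
by apply/isometryP; split=> [a u v|v]; rewrite !permM ?lg ?lh ?ih ?ig.
Qed.

Canonical isometry_group (F : finFieldType) (N : nat) (Q : 'rV[F]_N -> F) :
  {group {perm 'rV[F]_N}} := Group (isometry_group_set Q).

Definition Omega (F : finFieldType) (N : nat) (Q : 'rV[F]_N -> F) :
  {set {perm 'rV[F]_N}} := ((isometry Q)^`(1))%g.

Definition num_involutions (gT : finGroupType) (X : {set gT}) : nat :=
  #|[set g in X | (g ^+ 2 == 1)%g]|.

Definition infinite_prod (R : realType) (u : nat -> R) : R :=
  limn (fun N : nat => \prod_(1 <= i < N.+1) u i : R).

(* Main.v *)
(* An involution is g = 1 + M with M^2 = 0 and Q(vM) = B(v, vM), B being the polar form
   of Q.  Its row space W is totally isotropic, with orthogonal ker M, and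
   B(u, vM) induces a nondegenerate symmetric form on W with diagonal Q.

   If Q does not vanish on W this form can be diagonalised, so g is a product of
   rank M commuting orthogonal transvections v |-> v + B(v, w) w with Q(w) = 1.
   These are all conjugate when n >= 3, and the Dickson invariant is 1 on each;
   hence such a g lies in Omega exactly when rank M is even.  Adding or
   removing one transvection gives, for the number x_r of such g of rank r,
     x_{r+1} (q^r - [r+1 odd]) = x_r (q^(2n-r-1) - q^(r-1)),
   and x_1 = #{Q = 1} = q^(2n-1) +- q^(n-1) comes from a second moment count.
   The involutions with Q = 0 on W are negligible: multiplying them by
   transvections injects about q^(n-1) copies of them into the others (the rank
   n ones have to be lowered in rank first).

   With p = q^-2 and P_k = prod_{i <= k} (1 - p^i), the recursion gives
   x_{n-j} / q^(n^2) = q^(-j^2) P_n / (P_j P_{n-j}) up to O(q^-n), and by Euler's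
   q-binomial identity the sum of z^j times these values is
   prod_{i <= n} (1 + z / q^(2i-1)).  The values z = 1 and z = -1
   isolate the even ranks. *)

Require Import Defs.
From HB Require Import structures.
From mathcomp Require Import all_boot all_order all_algebra all_fingroup all_solvable.
From mathcomp Require Import all_classical all_reals all_analysis.
From mathcomp Require Import mxabelem finfield zify ring lra.
Import Order.TTheory GRing.Theory Num.Theory.
Import numFieldNormedType.Exports.

Set Implicit Arguments.
Unset Strict Implicit.
Unset Printing Implicit Defensive.
Local Open Scope ring_scope.

(* [all_algebra] exports another [isometry], from sesquilinear. *)
Local Notation isometry := Defs.isometry.

(** * Involutions of orthogonal groups in characteristic 2 *)

Section Forms.
Variables (F : finFieldType) (N : nat) (Q : 'rV[F]_N -> F).
Hypotheses (F2 : 2%N \in [pchar F]) (Qq : is_quadratic_form Q) (Qnd : non_defective Q).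

Local Notation B := (polar_form Q).
Local Notation V := 'rV[F]_N.

(** * Quadratic forms and their Gram matrices in characteristic 2 *)

Lemma sqr_inj (a b : F) : a ^+ 2 = b ^+ 2 -> a = b.
Proof.
move=> /eqP; rewrite -subr_eq0 subr_sqr mulf_eq0 => /orP[|].
  by rewrite subr_eq0 => /eqP.
by rewrite addr_eq0 oppr_pchar2 // => /eqP.
Qed.

Lemma sqrt_exists (a : F) : exists c, c ^+ 2 = a.
Proof. by exists (invF sqr_inj a); exact: (f_invF sqr_inj a). Qed.

Lemma mx_addrr m k (A : 'M[F]_(m, k)) : A + A = 0.
Proof. by apply/matrixP => i j; rewrite !mxE addrr_pchar2. Qed.

Lemma quadZ (a : F) (v : V) : Q (a *: v) = a ^+ 2 * Q v.
Proof. by case: Qq. Qed.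

Lemma quad0 : Q 0 = 0.
Proof. by rewrite -(scale0r (0 : V)) quadZ expr0n mul0r. Qed.

Lemma quadD (u v : V) : Q (u + v) = Q u + Q v + B u v.
Proof. by rewrite /polar_form; ring. Qed.

Lemma polarC (u v : V) : B u v = B v u.
Proof. by rewrite /polar_form (addrC u v) addrAC. Qed.

Lemma polarDr (u v w : V) : B u (v + w) = B u v + B u w.
Proof. by case: Qq => _ h _; have := h u 1 v w; rewrite scale1r mul1r. Qed.

Lemma polar0r (u : V) : B u 0 = 0.
Proof. by rewrite /polar_form addr0 quad0 subr0 subrr. Qed.

Lemma polar0l (u : V) : B 0 u = 0.
Proof. by rewrite polarC polar0r. Qed.

Lemma polarZr (a : F) (u v : V) : B u (a *: v) = a * B u v.
Proof.
by case: Qq => _ h _; have := h u a v 0; rewrite !addr0 polar0r addr0.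
Qed.

Lemma polarDl (u v w : V) : B (u + v) w = B u w + B v w.
Proof. by rewrite !(polarC _ w) polarDr. Qed.

Lemma polarZl (a : F) (u v : V) : B (a *: u) v = a * B u v.
Proof. by rewrite !(polarC _ v) polarZr. Qed.

Lemma polarvv (v : V) : B v v = 0.
Proof.
by rewrite /polar_form mx_addrr quad0 sub0r oppr_pchar2 // addrr_pchar2.
Qed.

Lemma polar_eq0 (u : V) : (forall v, B v u = 0) -> u = 0.
Proof. by move=> h; apply: Qnd => v; rewrite polarC. Qed.

Lemma quadZV (v : V) : Q v != 0 -> exists c, c != 0 /\ Q (c *: v) = 1.
Proof.
move=> Qv; have [c cE] := sqrt_exists (Q v)^-1; exists c; split.
  by apply/eqP => c0; move: cE; rewrite c0 expr0n /= => /esym/eqP; rewrite invr_eq0 (negPf Qv).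
by rewrite quadZ cE mulVf.
Qed.

Definition gram : 'M[F]_N := \matrix_(i, j) B (delta_mx 0 i) (delta_mx 0 j).

Lemma polarE (u v : V) : (u *m gram *m v^T) 0 0 = B u v.
Proof.
have hr (w : V) : (u *m gram *m w^T) 0 0 = \sum_j w 0 j * (\sum_i u 0 i * gram i j).
  by rewrite mxE; apply: eq_bigr => j _; rewrite !mxE mulrC.
rewrite hr [v in RHS]row_sum_delta.
rewrite (big_morph (B u) (polarDr u) (polar0r u)); apply: eq_bigr => j _.
rewrite polarZr [u in RHS]row_sum_delta.
rewrite (big_morph (B^~ _) (fun x y => polarDl x y _) (polar0l _)); congr (_ * _).
by apply: eq_bigr => i _; rewrite polarZl !mxE.
Qed.

Lemma gram_tr : gram^T = gram.
Proof. by apply/matrixP => i j; rewrite !mxE polarC. Qed.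

Lemma gram_unit : gram \in unitmx.
Proof.
rewrite -row_free_unit -kermx_eq0; apply/eqP/row_matrixP => i.
rewrite row0; apply: Qnd => v; rewrite -polarE.
by rewrite -row_mul mulmx_ker row0 mul0mx mxE.
Qed.

Lemma polar_mulmx (A A' : 'M[F]_N) :
  (forall u v : V, B (u *m A) v = B u (v *m A')) -> A *m gram = gram *m A'^T.
Proof.
move=> h; apply/matrixP => i j.
have := h (delta_mx 0 i) (delta_mx 0 j).
rewrite -!polarE !trmx_mul !mulmxA -!(mulmxA (delta_mx 0 i)) -!rowE.
by rewrite !trmx_delta -!colE !mxE.
Qed.

(* Says that 1 + M is an isometry of Q with square 1. *)
Definition invol (M : 'M[F]_N) : bool :=
  (M *m M == 0) && [forall v : V, Q (v *m M) == B v (v *m M)].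

Lemma involP (M : 'M[F]_N) :
  reflect (M *m M = 0 /\ forall v : V, Q (v *m M) = B v (v *m M)) (invol M).
Proof.
apply: (iffP andP) => [[/eqP h /forallP h2]|[h h2]]; split=> //.
- by move=> v; apply/eqP.
- by apply/eqP.
- by apply/forallP => v; apply/eqP.
Qed.

Arguments involP {M}.

(* When Q w = 1, [1 + tau w] is the orthogonal transvection along w. *)
Definition tau (w : V) : 'M[F]_N := gram *m w^T *m w.

Lemma mul_tau (v w : V) : v *m tau w = B v w *: w.
Proof.
rewrite /tau !mulmxA [v *m gram *m w^T]mx11_scalar mul_scalar_mx.
by rewrite polarE.
Qed.

(** * Image and kernel of an involution *)

Section Involution.
Variables (M : 'M[F]_N).
Hypothesis (MI : invol M).

Let MM : M *m M = 0. Proof. by case/involP: MI. Qed.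
Let QM v : Q (v *m M) = B v (v *m M). Proof. by case/involP: MI. Qed.

Lemma mulMM (v : V) : v *m M *m M = 0.
Proof. by rewrite -mulmxA MM mulmx0. Qed.

(** Polarising Q(vM) = B(v, vM) gives B(xM, yM) = B(x, yM) + B(y, xM). Taking x = uM makes every
    term but B(uM, vM) vanish, since M^2 = 0. *)
Lemma invol_iso (u v : V) : B (u *m M) (v *m M) = 0.
Proof.
have h x y : B (x *m M) (y *m M) = B x (y *m M) + B y (x *m M).
  have := QM (x + y); rewrite mulmxDl quadD !QM polarDl !polarDr => e.
  by apply: (addrI (B x (x *m M) + B y (y *m M))); rewrite e; ring.
by have := h (u *m M) v; rewrite mulMM polar0l polar0r addr0 => /esym.
Qed.

Lemma invol_adj (u v : V) : B (u *m M) v = B u (v *m M).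
Proof.
have := QM (u + v); rewrite mulmxDl quadD !QM polarDl !polarDr invol_iso => e.
have e2 : B u (v *m M) + B v (u *m M) = 0.
  by apply: (addrI (B u (u *m M) + B v (v *m M))); rewrite e; ring.
by rewrite polarC; apply/eqP; rewrite -subr_eq0 oppr_pchar2 // addrC e2.
Qed.

Lemma invol_sub (w : V) : (w <= M)%MS -> w *m M = 0.
Proof. by case/submxP => u ->; rewrite mulMM. Qed.

Lemma invol_ker_perp (u w : V) : u *m M = 0 -> (w <= M)%MS -> B u w = 0.
Proof. by move=> uM /submxP[v ->]; rewrite -invol_adj uM polar0l. Qed.

Lemma invol_sub_iso (u w : V) : (u <= M)%MS -> (w <= M)%MS -> B u w = 0.
Proof. by move/invol_sub; exact: invol_ker_perp. Qed.

(** The row space of M is the full orthogonal of ker M. If w is orthogonal to ker M, the column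
    [gram *m w^T] is annihilated by the left kernel of M, so by equality of ranks it lies in the
    column space of M; self-adjointness of M turns this into w being in the row space. *)
Lemma invol_notin (w : V) : ~~ (w <= M)%MS -> exists v, v *m M = 0 /\ B v w = 1.
Proof.
move=> wM.
have [v /andP[/eqP vM vw]] : exists v : V, (v *m M == 0) && (B v w != 0).
  apply/existsP; apply: contraT; rewrite negb_exists => /forallP h.
  pose K := kermx M.
  have Kw : K *m (gram *m w^T) = 0.
    apply/row_matrixP => i; rewrite row0 row_mul; apply/rowP => j.
    rewrite (ord1 j) mulmxA polarE [RHS]mxE; apply/eqP.
    have := h (row i K); rewrite -row_mul mulmx_ker row0 eqxx /= negbK; exact.
  have MK : (M^T <= kermx K^T)%MS.
    by apply/sub_kermxP; rewrite -trmx_mul mulmx_ker trmx0.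
  have KM : (kermx K^T <= M^T)%MS.
    have := mxrank_leqif_sup MK; rewrite mxrank_ker !mxrank_tr mxrank_ker.
    by rewrite subKn ?rank_leq_row // => -[_]; rewrite eqxx.
  have : ((gram *m w^T)^T <= M^T)%MS.
    by apply: submx_trans KM; apply/sub_kermxP; rewrite -trmx_mul Kw trmx0.
  rewrite trmx_mul trmxK gram_tr => /submxP[y yE].
  case/negP: wM; apply/submxP; exists (y *m invmx gram).
  rewrite -(mulmxK gram_unit w) yE -!mulmxA; congr (_ *m _).
  by rewrite -[RHS](mulmxK gram_unit) -(mulmxA _ M gram) (polar_mulmx invol_adj) mulKmx ?gram_unit.
exists ((B v w)^-1 *: v); split; first by rewrite -scalemxAl vM scaler0.
by rewrite polarZl mulVf.
Qed.

(** Since wM = 0, self-adjointness gives B(vM, w) = 0, so all cross terms between M and [tau w]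
    vanish. *)
Lemma invol_tau (w : V) : w *m M = 0 -> Q w = 1 -> invol (M + tau w).
Proof.
move=> wM Qw; have tM (v : V) : v *m (M + tau w) = v *m M + B v w *: w.
  by rewrite mulmxDr mul_tau.
have Bw v : B (v *m M) w = 0 by rewrite invol_adj wM polar0r.
apply/involP; split.
  apply/row_matrixP => i; rewrite row0 rowE mulmxA !tM mulmxDl mulMM add0r.
  rewrite -scalemxAl wM scaler0 add0r polarDl Bw polarZl polarvv mulr0.
  by rewrite addr0 scale0r.
move=> v; rewrite tM quadD quadZ Qw QM polarZr Bw polarDr polarZr; ring.
Qed.

(** By [invol_notin] some v in ker M has B(v, w) = 1. It is sent to w by [M + tau w], whose row
    space is therefore that of M plus the line of w. *)
Lemma tau_rank (w : V) : ~~ (w <= M)%MS ->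
  (w <= (M + tau w)%R)%MS /\ \rank (M + tau w)%R = (\rank M).+1.
Proof.
move=> wM; have [v [vM vw]] := invol_notin wM.
have wT : (w <= (M + tau w)%R)%MS.
  by apply/submxP; exists v; rewrite mulmxDr mul_tau vM vw add0r scale1r.
split=> //; have w0 : w != 0 by apply: contraNneq wM => ->; exact: sub0mx.
have tw : (tau w <= w)%MS by rewrite /tau submxMl.
have Mw : ((M + tau w)%R :=: M + w)%MS.
  apply/eqmxP; apply/andP; split.
    by rewrite addmx_sub ?addsmxSl // (submx_trans tw) ?addsmxSr.
  rewrite addsmx_sub wT andbT.
  have {1}-> : M = (M + tau w) + tau w by rewrite -addrA mx_addrr addr0.
  by rewrite addmx_sub // (submx_trans tw).
rewrite Mw; have := mxrank_sum_cap M w; rewrite rank_rV w0.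
suff -> : \rank (M :&: w)%MS = 0%N by rewrite addn0 addn1.
apply/eqP; rewrite mxrank_eq0; apply: contraT => /rowV0Pn[u]. 
rewrite sub_capmx => /andP[uM /sub_rVP[a ua]] u0; case/negP: wM.
move: uM; rewrite ua eqmx_scale //; apply: contraNneq u0 => a0.
by rewrite ua a0 scale0r.
Qed.

End Involution.

(** * Splitting off transvections *)

Lemma tauK (M : 'M[F]_N) (w : V) : M + tau w + tau w = M.
Proof. by rewrite -addrA mx_addrr addr0. Qed.

(** Write w = vM. Then B(v, w) = Q(w) = 1, so v is killed by [M + tau w] without being orthogonal to
    w; hence w is not in the new image, and [tau_rank] applies backwards. *)
Lemma tau_notin (M : 'M[F]_N) (w : V) : invol M -> (w <= M)%MS -> Q w = 1 ->
  [/\ ~~ (w <= (M + tau w)%R)%MS, w *m (M + tau w) = 0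
    & \rank M = (\rank (M + tau w)%R).+1].
Proof.
move=> MI wM Qw; have wM0 := invol_sub MI wM.
have MI' := invol_tau MI wM0 Qw.
have [_ QM] := involP MI.
have wM' : ~~ (w <= (M + tau w)%R)%MS.
  case/submxP: (wM) => v vM; apply/negP => wM'.
  have vw : B v w = 1 by rewrite vM -QM -vM.
  have : B v w = 0.
    apply: (invol_ker_perp MI') => //.
    by rewrite mulmxDr mul_tau vw scale1r -vM mx_addrr.
  by rewrite vw => /eqP; rewrite oner_eq0.
split=> //; first by rewrite mulmxDr mul_tau polarvv scale0r addr0.
by have [_] := tau_rank MI' wM'; rewrite tauK.
Qed.

(* Such a w represents the diagonal of the form B(u, vM); by [diag_vector_tau],
   it is the only w along which splitting off a transvection leaves an
   involution of alternating type. *)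
Definition diag_vector (M : 'M[F]_N) (w : V) := forall v : V, B v (v *m M) = B v w ^+ 2.

Lemma diag_vector_uniq M (w w' : V) : diag_vector M w -> diag_vector M w' -> w = w'.
Proof.
move=> h h'; apply/eqP; rewrite -subr_eq0; apply/eqP/polar_eq0 => v.
rewrite polarDr -scaleN1r polarZr mulN1r; apply/eqP; rewrite subr_eq0; apply/eqP.
by apply: sqr_inj; rewrite -h -h'.
Qed.

Lemma diag_vector_tau M (w : V) : invol M -> w *m M = 0 -> Q w = 1 ->
  diag_vector M w <-> forall v, Q (v *m (M + tau w)) = 0.
Proof.
move=> MI wM Qw; have [_ QM] := involP MI.
have E v : Q (v *m (M + tau w)) = B v (v *m M) + B v w ^+ 2.
  rewrite mulmxDr mul_tau quadD polarZr invol_adj // wM polar0r quadZ Qw QM.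
  ring.
split=> [h v|h v]; first by rewrite E h addrr_pchar2.
by apply/eqP; rewrite -subr_eq0 oppr_pchar2 // -E h.
Qed.

(* There is at most one bad choice of w, so two candidates always suffice. *)
Lemma exists_splitting M (v : V) : invol M -> Q (v *m M) != 0 ->
  exists w, [/\ (w <= M)%MS, Q w = 1 &
    (exists u, Q (u *m (M + tau w)) != 0) \/ M = tau w].
Proof.
move=> MI Qv; have [_ QM] := involP MI.
have [c [c0 Qw]] := quadZV Qv; set w := c *: _ in Qw.
have wM : (w <= M)%MS by rewrite scalemx_sub ?submxMl.
have good w' : (w' <= M)%MS -> Q w' = 1 -> ~ diag_vector M w' ->
    exists u, Q (u *m (M + tau w')) != 0.
  move=> w'M Qw' nb; apply/existsP; apply: contraT; rewrite negb_exists.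
  move=> /forallP h; case: nb; apply/(diag_vector_tau MI (invol_sub MI w'M) Qw') => u.
  by have := h u; rewrite negbK => /eqP.
have [/existsP[w' /and3P[w'M /eqP Qw' ww']]|] :=
  boolP [exists w', [&& (w' <= M)%MS, Q w' == 1 & w' != w]].
  have [/forallP b|nb] := boolP [forall u, B u (u *m M) == B u w ^+ 2]; last first.
    exists w; split=> //; left; apply: good => // b; case/negP: nb.
    by apply/forallP => u; apply/eqP.
  exists w'; split=> //; left; apply: good => // b'; case/eqP: ww'.
  by apply: (diag_vector_uniq b') => u; apply/eqP.
(* Here w is the only vector of the row space with Q = 1. For each u, either Q(uM) = 0, and w + uM =
   w forces uM = 0, or a multiple of uM equals w; both cases give uM = B(u, w) w. *)
rewrite negb_exists => /forallP uq; exists w; split=> //; right.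
have {}uq w' : (w' <= M)%MS -> Q w' = 1 -> w' = w.
  by move=> h1 h2; have := uq w'; rewrite h1 h2 eqxx /= negbK => /eqP.
have MI' := invol_tau MI (invol_sub MI wM) Qw.
apply/row_matrixP => i; rewrite !rowE; set u := delta_mx _ _; rewrite mul_tau.
have [Qu|Qu] := eqVneq (Q (u *m M)) 0.
  have /(canRL (addKr _)) : w + u *m M = w.
    apply: uq; first by rewrite addmx_sub ?submxMl.
    by rewrite quadD Qu addr0 Qw (invol_sub_iso MI) ?addr0 ?submxMl.
  rewrite addNr => uM0; rewrite uM0.
  by rewrite (invol_ker_perp MI) // scale0r.
have [d [d0 Qd]] := quadZV Qu.
have /(canRL (scalerK d0)) uM : d *: (u *m M) = w.
  by apply: uq => //; rewrite scalemx_sub ?submxMl.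
have := QM u; rewrite uM quadZ Qw mulr1 polarZr expr2.
have dV : d^-1 != 0 by rewrite invr_eq0.
by move/(mulfI dV) => <-.
Qed.

(* The permutation v |-> v + v M when M is an involution; arbitrary otherwise. *)
Definition iperm (M : 'M[F]_N) : {perm V} :=
  odflt 1%g [pick g : {perm V} | [forall v, g v == v + v *m M]].

Lemma ipermE (M : 'M[F]_N) : invol M -> forall v, iperm M v = v + v *m M.
Proof.
move=> MI; have [MM _] := involP MI.
have inj : injective (fun v : V => v + v *m M).
  apply: (can_inj (g := fun v => v + v *m M)) => v.
  by rewrite mulmxDl (mulMM MI) addr0 -addrA mx_addrr addr0.
rewrite /iperm; case: pickP => [g /forallP gE v|/(_ (perm inj))]; first exact/eqP.
by move/negP; case; apply/forallP => v; rewrite permE.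
Qed.

Lemma iperm_isometry (M : 'M[F]_N) : invol M -> iperm M \in isometry Q.
Proof.
move=> MI; apply/isometryP; split=> [a u v|v]; rewrite !(ipermE MI).
  by rewrite mulmxDl -scalemxAl scalerDr !addrA; congr (_ + _); rewrite addrAC.
have [_ QM] := involP MI.
by rewrite quadD QM -addrA addrr_pchar2 // addr0.
Qed.

Lemma iperm0 : iperm 0 = 1%g.
Proof.
apply/permP => v; rewrite ipermE ?perm1 ?mulmx0 ?addr0 //.
by apply/involP; split=> [|u]; rewrite !mulmx0 ?quad0 ?polar0r.
Qed.

Lemma invol0 : invol 0.
Proof. by apply/involP; split=> [|u]; rewrite !mulmx0 ?quad0 ?polar0r. Qed.

Lemma invol_tau0 (w : V) : Q w = 1 -> invol (tau w).
Proof. by move=> Qw; rewrite -[tau w]add0r invol_tau ?invol0 ?mulmx0. Qed.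

Lemma iperm_tau (M : 'M[F]_N) (w : V) : invol M -> w *m M = 0 -> Q w = 1 ->
  iperm (M + tau w) = (iperm M * iperm (tau w))%g.
Proof.
move=> MI wM Qw; apply/permP => v.
rewrite permM !ipermE ?invol_tau ?invol_tau0 //.
rewrite mulmxDl mulmxDr !mul_tau addrA.
by rewrite (invol_adj MI) wM polar0r scale0r addr0.
Qed.

(** Induction on the rank, removing one transvection at a time. If w0 is the diagonal vector of
    [M + tau w], that of M is w0 + w; the two are orthogonal, so Q grows by 1. The parity of the
    rank thus tells whether the diagonal vector is among the vectors with Q = 1, which is the source
    of the odd-rank correction in the recursion. *)
Lemma diag_decomp (M : 'M[F]_N) : invol M ->
    (exists v, Q (v *m M) != 0) \/ M = 0 ->
  (exists s : seq V, [/\ size s = \rank M, (forall w, w \in s -> Q w = 1)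
     & iperm M = (\prod_(w <- s) iperm (tau w))%g]) /\
  (exists w, [/\ (w <= M)%MS, diag_vector M w & Q w = (\rank M)%:R]).
Proof.
have [r rE] := ubnP (\rank M); elim: r M rE => // r IH M rE MI.
have base : (exists s : seq V, [/\ size s = \rank (0 : 'M[F]_N),
      (forall w, w \in s -> Q w = 1)
     & iperm 0 = (\prod_(w <- s) iperm (tau w))%g]) /\
  (exists w, [/\ (w <= (0 : 'M[F]_N))%MS, diag_vector 0 w
      & Q w = (\rank (0 : 'M[F]_N))%:R]).
  rewrite mxrank0; split.
    by exists [::]; split=> //; rewrite big_nil iperm0.
  by exists 0; split=> [||]; rewrite ?sub0mx ?quad0 // => v;
    rewrite mulmx0 !polar0r expr0n.
case=> [[v Qv]|->]; last exact: base.
have [w [wM Qw ww]] := exists_splitting MI Qv.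
have [wM' wM0 rM] := tau_notin MI wM Qw.
have MI' := invol_tau MI (invol_sub MI wM) Qw.
have [||[s [s1 s2 s3]] [w0 [w0M bw0 Qw0]]] := IH (M + tau w) _ MI'.
- by move: rE; rewrite rM.
- case: ww => [|->]; first by left.
  by right; rewrite mx_addrr.
split.
  exists (rcons s w); split; first by rewrite size_rcons s1 rM.
    by move=> u; rewrite mem_rcons inE => /orP[/eqP->//|/s2].
  by rewrite -{1}(tauK M w) iperm_tau // s3 -cats1 big_cat big_seq1.
exists (w0 + w); split.
- rewrite addmx_sub // (submx_trans w0M) // addmx_sub // (submx_trans _ wM) //.
  by rewrite /tau submxMl.
- move=> u; have := bw0 u; rewrite mulmxDr mul_tau !polarDr polarZr => e.
  rewrite sqrrD -e -expr2 -addrA (addrC (_ *+ 2)) -mulr_natr (pcharf0 F2) mulr0.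
  by rewrite addr0 -addrA addrr_pchar2 // addr0.
rewrite quadD Qw0 Qw rM polarC (invol_ker_perp MI') // addr0.
by rewrite -natr1.
Qed.

(** * Conjugacy of transvections, and even products in the derived subgroup *)

(** The transvection along a multiple of w + w' sends w to w'; it exists because Q(w + w') = B(w,
    w') is nonzero. *)
Lemma isometry_tau_move (w w' : V) : Q w = 1 -> Q w' = 1 -> B w w' != 0 ->
  exists2 h, h \in isometry Q & h w = w'.
Proof.
move=> Qw Qw' b0; set b := B w w' in b0.
have Qu : Q (w + w') = b by rewrite quadD Qw Qw' addrr_pchar2 // add0r.
have [|c [c0 Qc]] := @quadZV (w + w'); first by rewrite Qu.
exists (iperm (tau (c *: (w + w')))); first by rewrite iperm_isometry ?invol_tau0.
rewrite ipermE ?invol_tau0 // mul_tau polarZr polarDr polarvv add0r scalerA.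
rewrite mulrAC -expr2; move: Qc; rewrite quadZ Qu => ->.
by rewrite scale1r addrA mx_addrr add0r.
Qed.

(** Provides the intermediate point x of a two-step move from w to w'. First x is made
    non-orthogonal to both; then a vector y orthogonal to both is added to make Q nonzero, and the
    result is rescaled. *)
Lemma exists_nonorthogonal_unit (w w' : V) : (4 < N)%N -> w != 0 -> w' != 0 ->
  exists2 x, Q x = 1 & (B w x != 0) && (B x w' != 0).
Proof.
move=> N4 w0 w'0.
have nd (u : V) : u != 0 -> exists v, B v u != 0.
  move=> u0; apply/existsP; apply: contraT; rewrite negb_exists => /forallP h.
  case/eqP: u0; apply: polar_eq0 => v; apply/eqP; have := h v.
  by rewrite negbK.
have [u uw] := nd _ w0; have [u' uw'] := nd _ w'0.
have [x /andP[xw xw']] : exists x, (B x w != 0) && (B x w' != 0).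
  have [e|ne] := eqVneq (B u w') 0; last by exists u; rewrite uw.
  have [e'|ne'] := eqVneq (B u' w) 0; last by exists u'; rewrite uw' ne'.
  by exists (u + u'); rewrite !polarDl e e' addr0 add0r uw.
have [y [yw yw' Qy]] : exists y, [/\ B y w = 0, B y w' = 0 & Q (x + y) != 0].
  have [Qx|Qx] := eqVneq (Q x) 0; last first.
    by exists 0; rewrite !polar0l addr0.
  pose C := gram *m row_mx w^T w'^T.
  pose P := kermx C.
  have PC (y : V) : (y <= P)%MS -> B y w = 0 /\ B y w' = 0.
    move=> /sub_kermxP; rewrite /C mulmxA mul_mx_row => e.
    have [e1 e2] : y *m gram *m w^T = 0 /\ y *m gram *m w'^T = 0.
      by apply/eq_row_mx; rewrite e row_mx0.
    by rewrite -!polarE e1 e2 mxE.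
  have [/existsP[y /andP[yP Qy]]|] := boolP [exists y : V, (y <= P)%MS && (Q (x + y) != 0)].
    by exists y; have [] := PC y yP.
  rewrite negb_exists => /forallP h.
  (* If no y works, Q coincides on P with the linear form B(x, -), so P is totally isotropic. As P
     has dimension at least N - 2, this forces N <= 4. *)
  have {}h (y : V) : (y <= P)%MS -> Q y = B x y.
    move=> yP; have := h y; rewrite yP /= negbK quadD Qx add0r => /eqP e.
    by apply/eqP; rewrite -subr_eq0 oppr_pchar2 // e.
  have iso (y z : V) : (y <= P)%MS -> (z <= P)%MS -> B y z = 0.
    move=> yP zP; have := h (y + z) (addmx_sub yP zP).
    rewrite quadD polarDr !h // => e.
    by apply: (addrI (B x y + B x z)); rewrite e addr0.
  have PP : (P <= kermx (gram *m P^T))%MS.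
    apply/sub_kermxP/matrixP => i j; rewrite [RHS]mxE -(iso (row i P) (row j P)) ?row_sub //.
    rewrite -polarE mulmxA -row_mul [LHS]mxE [RHS]mxE.
    by apply: eq_bigr => k _; rewrite !mxE.
  have := mxrankS PP; rewrite (mxrank_ker (gram *m P^T)).
  have -> : \rank (gram *m P^T) = \rank P.
    by rewrite -mxrank_tr trmx_mul trmxK gram_tr mxrankMfree // row_free_unit gram_unit.
  move=> le; exfalso; have := rank_leq_col C; have : \rank P = (N - \rank C)%N := mxrank_ker C; lia.
have [c [c0 Qc]] := quadZV Qy.
exists (c *: (x + y)) => //.
by rewrite polarC !polarZl !polarDl yw yw' !addr0 !mulf_neq0.
Qed.

Lemma isometry_unit_transitive (w w' : V) : (4 < N)%N -> Q w = 1 -> Q w' = 1 ->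
  exists2 h, h \in isometry Q & h w = w'.
Proof.
move=> N4 Qw Qw'.
have nz (u : V) : Q u = 1 -> u != 0.
  by move=> e; apply/eqP => u0; move/eqP: e; rewrite u0 quad0 eq_sym oner_eq0.
have [x Qx /andP[wx xw']] := exists_nonorthogonal_unit N4 (nz _ Qw) (nz _ Qw').
have [h hO hw] := isometry_tau_move Qw Qx wx.
have [h' h'O hw'] := isometry_tau_move Qx Qw' xw'.
by exists (h * h')%g; rewrite ?groupM //= permM hw hw'.
Qed.

Lemma isometry_polar g : g \in isometry Q -> forall u v, B (g u) (g v) = B u v.
Proof.
case/isometryP => gl gQ u v.
by have := gl 1 u v; rewrite /polar_form !scale1r => <-; rewrite !gQ.
Qed.

(** If h sends w to w', conjugation by h sends the transvection along w to the one along w', so the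
    product is a commutator. *)
Lemma two_tau_Omega (w w' : V) : (4 < N)%N -> Q w = 1 -> Q w' = 1 ->
  (iperm (tau w) * iperm (tau w'))%g \in Omega Q.
Proof.
move=> N4 Qw Qw'; have [h hO hw] := isometry_unit_transitive N4 Qw Qw'.
have tO u (Qu : Q u = 1) : iperm (tau u) \in isometry Q.
  by rewrite iperm_isometry ?invol_tau0.
have /isometryP[hl hQ] := hO.
suff -> : (iperm (tau w) * iperm (tau w') = [~ iperm (tau w), h])%g.
  by rewrite /Omega derg1 mem_commg ?tO.
rewrite /commg; congr (_ * _)%g.
  apply/permP => v; apply: (canRL (permK _)).
  rewrite !ipermE ?invol_tau0 // mulmxDl !mul_tau polarZl polarvv mulr0.
  by rewrite scale0r addr0 -addrA mx_addrr addr0.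
apply/permP => v; rewrite conjgE !permM [RHS]/=.
set v' := (h^-1)%g v; have -> : v = h v' by rewrite /v' permKV.
rewrite !ipermE ?invol_tau0 // !mul_tau -hw isometry_polar //.
by rewrite addrC -(hl _ w v') addrC.
Qed.

Lemma even_Omega (M : 'M[F]_N) : (4 < N)%N -> invol M ->
  (exists v, Q (v *m M) != 0) -> ~~ odd (\rank M) -> iperm M \in Omega Q.
Proof.
move=> N4 MI nd; have [[s [<- s1 ->]] _] := diag_decomp MI (or_introl nd).
have [k kE] := ubnP (size s); elim: k s kE s1 => // k IH [|w [|w' s]] //=.
  by rewrite big_nil group1.
move=> kE s1 od; rewrite !big_cons mulgA groupM //.
  by rewrite two_tau_Omega ?s1 ?inE ?eqxx ?orbT.
apply: IH; first by move: kE; lia.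
  by move=> u us; rewrite s1 // !inE us !orbT.
by rewrite negbK in od.
Qed.

(** * The Dickson invariant *)

(** A triangular matrix representing Q; in characteristic 2 the Gram matrix of the polar form does
    not determine Q. *)
Definition quad_mx : 'M[F]_N :=
  \matrix_(i, j) if i == j then Q (delta_mx 0 i)
                 else if (i < j)%N then gram i j else 0.

Lemma quad_mxD_tr : quad_mx + quad_mx^T = gram.
Proof.
apply/matrixP => i j; rewrite !mxE (eq_sym j i).
have [->|ij] := eqVneq i j; first by rewrite addrr_pchar2 // polarvv.
case: (ltngtP i j) => [||/val_inj]; rewrite ?addr0 ?add0r //.
  by rewrite polarC.
by move=> e; rewrite e eqxx in ij.
Qed.

Lemma mx11D (A A' : 'M[F]_1) : (A + A') 0 0 = A 0 0 + A' 0 0.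
Proof. by rewrite mxE. Qed.

(** Both sides are quadratic with the same polar form, so their difference is additive; it vanishes
    on multiples of basis vectors. *)
Lemma mul_quad_mx (v : V) : (v *m quad_mx *m v^T) 0 0 = Q v.
Proof.
pose q (v : V) := (v *m quad_mx *m v^T) 0 0.
have qD u w : q (u + w) = q u + q w + B u w.
  rewrite -polarE -quad_mxD_tr /q linearD /= !mulmxDl !mulmxDr mulmxDl !mx11D.
  have <- : (w *m quad_mx *m u^T) 0 0 = (u *m quad_mx^T *m w^T) 0 0.
    have : (u *m quad_mx^T *m w^T)^T 0 0 = (u *m quad_mx^T *m w^T) 0 0 by rewrite mxE.
    by rewrite !trmx_mul !trmxK mulmxA.
  by ring.
have qZ a w : q (a *: w) = a ^+ 2 * q w.
  by rewrite /q linearZ /= -!scalemxAl -scalemxAr scalerA [LHS]mxE expr2.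
have qe i : q (delta_mx 0 i) = Q (delta_mx 0 i).
  by rewrite /q -rowE trmx_delta -colE !mxE eqxx.
pose d w := q w - Q w.
have dD u w : d (u + w) = d u + d w by rewrite /d qD quadD; ring.
have d0 : d 0 = 0 by rewrite /d /q quad0 !mul0mx mxE subr0.
have : d v = 0.
  rewrite [v]row_sum_delta (big_morph d dD d0) big1 // => i _.
  by rewrite /d qZ quadZ qe subrr.
by move/eqP; rewrite subr_eq0 => /eqP.
Qed.

Definition upper (E : 'M[F]_N) : 'M[F]_N :=
  \matrix_(i, j) if (i < j)%N then E i j else 0.

(* An alternating matrix is U + U^T, with U its strictly upper triangular part. *)
Lemma upperK (E : 'M[F]_N) : (forall v : V, (v *m E *m v^T) 0 0 = 0) ->
  E = upper E + (upper E)^T.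
Proof.
move=> h.
have D i j : (delta_mx (0 : 'I_1) i *m E *m (delta_mx (0 : 'I_1) j)^T) 0 0 = E i j.
  by rewrite -rowE trmx_delta -colE !mxE.
have Eii i : E i i = 0 by rewrite -D h.
have Eij i j : E i j + E j i = 0.
  have := h (delta_mx 0 i + delta_mx 0 j).
  rewrite linearD /= !mulmxDl !mulmxDr !mx11D !D !Eii => e.
  by rewrite -[RHS]e; ring.
apply/matrixP => i j; rewrite !mxE; case: (ltngtP i j) => [||/val_inj->].
- by rewrite addr0.
- by move=> _; rewrite add0r -[E j i](oppr_pchar2 F2); apply/eqP; rewrite -addr_eq0 Eij.
- by rewrite Eii addr0.
Qed.

Lemma gramV_tr : (invmx gram)^T = invmx gram.
Proof. by rewrite trmx_inv gram_tr. Qed.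

(** The inverse Gram matrix is alternating, of the form K + K^T. For symmetric U the traces of KU
    and K^T U are equal and cancel. *)
Lemma mxtrace_alt_sym (U : 'M[F]_N) : U^T = U -> \tr (invmx gram *m U) = 0.
Proof.
move=> Us; pose K := invmx gram *m quad_mx *m invmx gram.
have -> : invmx gram = K + K^T.
  rewrite /K !trmx_mul gramV_tr mulmxA -mulmxDl -mulmxDr quad_mxD_tr.
  by rewrite mulVmx ?gram_unit // mul1mx.
rewrite mulmxDl linearD /= -(mxtrace_tr (K^T *m U)) trmx_mul trmxK Us.
by rewrite mxtrace_mulC addrr_pchar2.
Qed.

(* If A is an isometry, A T A^T + T is alternating, where T = quad_mx, hence equal
   to U + U^T for some U, unique up to symmetric matrices.  The latter do not
   contribute to the trace below, so that [dickson] is additive on products. *)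
Definition dickson (A : 'M[F]_N) : F :=
  \tr (invmx gram *m upper (A *m quad_mx *m A^T + quad_mx)).

Lemma dicksonE (A U : 'M[F]_N) : (forall v : V, Q (v *m A) = Q v) ->
  A *m quad_mx *m A^T + quad_mx = U + U^T -> dickson A = \tr (invmx gram *m U).
Proof.
move=> AQ AU; have dU : A *m quad_mx *m A^T + quad_mx =
    upper (A *m quad_mx *m A^T + quad_mx) + (upper (A *m quad_mx *m A^T + quad_mx))^T.
  apply: upperK => v; rewrite mulmxDr mulmxDl mx11D mul_quad_mx.
  by rewrite !mulmxA -mulmxA -trmx_mul mul_quad_mx AQ addrr_pchar2.
rewrite /dickson; set W := upper _ in dU *; move: dU; rewrite AU => e.
apply/eqP; rewrite -subr_eq0 -linearB /= -mulmxBr; apply/eqP/mxtrace_alt_sym.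
clearbody W; apply/matrixP => i j; have := congr1 (fun A : 'M[F]_N => A i j) e.
rewrite !mxE => eij; rewrite -[RHS](oppr_pchar2 F2).
apply/eqP; rewrite -subr_eq0 opprK; apply/eqP.
transitivity (W i j + W j i - (U i j + U j i)); first by ring.
by rewrite eij subrr.
Qed.

Lemma dicksonP (A : 'M[F]_N) : (forall v : V, Q (v *m A) = Q v) ->
  exists U, A *m quad_mx *m A^T + quad_mx = U + U^T.
Proof.
move=> AQ; exists (upper (A *m quad_mx *m A^T + quad_mx)).
apply: upperK => v; rewrite mulmxDr mulmxDl mx11D mul_quad_mx.
by rewrite !mulmxA -mulmxA -trmx_mul mul_quad_mx AQ addrr_pchar2.
Qed.

Lemma iso_gram (A : 'M[F]_N) : (forall v : V, Q (v *m A) = Q v) ->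
  A^T *m invmx gram *m A = invmx gram.
Proof.
move=> AQ.
have AJ : A *m gram *m A^T = gram.
  apply/matrixP => i j; have := polarE (delta_mx 0 i *m A) (delta_mx 0 j *m A).
  rewrite /polar_form -mulmxDl !AQ -/(B _ _) -polarE trmx_mul !mulmxA.
  rewrite -!(mulmxA (delta_mx 0 i)) -!rowE !trmx_delta.
  by rewrite -!colE !mxE.
have Au : A *m (gram *m A^T *m invmx gram) = 1%:M.
  by rewrite !mulmxA AJ mulmxV ?gram_unit.
have := mulmx1C Au; rewrite -!mulmxA => e.
by rewrite -[LHS](mulKmx gram_unit) e mulmx1.
Qed.

Lemma dicksonM (A A' : 'M[F]_N) : (forall v : V, Q (v *m A) = Q v) ->
  (forall v : V, Q (v *m A') = Q v) -> dickson (A *m A') = dickson A + dickson A'.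
Proof.
move=> AQ AQ'; have [U AU] := dicksonP AQ; have [U' AU'] := dicksonP AQ'.
rewrite (dicksonE AQ AU) (dicksonE AQ' AU').
(* Conjugating the decomposition for A' by A and adding that for A decomposes the one for A A'. The
   trace of the conjugated term is unchanged because A preserves the inverse Gram matrix. *)
rewrite (@dicksonE _ (A *m U' *m A^T + U)).
- rewrite mulmxDr linearD /= addrC; congr (_ + _).
  by rewrite -!mulmxA mulmxA mxtrace_mulC -!mulmxA mulmxA mxtrace_mulC mulmxA iso_gram.
- by move=> v; rewrite mulmxA AQ' AQ.
rewrite linearD /= addrACA -AU !trmx_mul trmxK !mulmxA -mulmxDl -mulmxDr -AU'.
rewrite !mulmxDr !mulmxDl !mulmxA addrA; congr (_ + _).
by rewrite -addrA mx_addrr addr0.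
Qed.

Lemma dickson1 : dickson 1%:M = 0.
Proof.
have Q1 (v : V) : Q (v *m 1%:M) = Q v by rewrite mulmx1.
by apply: (addrI (dickson 1%:M)); rewrite -dicksonM // mulmx1 addr0.
Qed.

Lemma dickson_tau (w : V) : Q w = 1 -> dickson (1%:M + tau w) = 1.
Proof.
move=> Qw.
have tQ (v : V) : Q (v *m (1%:M + tau w)) = Q v.
  have /isometryP[_ h] := iperm_isometry (invol_tau0 Qw).
  by rewrite mulmxDr mulmx1 -(ipermE (invol_tau0 Qw)).
(* With this choice of U the trace is that of w T w^T, for T = [quad_mx], which is Q(w) = 1. *)
rewrite (@dicksonE _ (gram *m w^T *m (w *m quad_mx))) //.
  rewrite -mulmxA !mulmxA mulVmx ?gram_unit // mul1mx -mulmxA mxtrace_mulC.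
  by rewrite /mxtrace big_ord_recl big_ord0 addr0 mul_quad_mx.
have tT : (tau w)^T = w^T *m w *m gram by rewrite /tau !trmx_mul trmxK gram_tr mulmxA.
have s : w *m quad_mx *m w^T = 1%:M.
  by rewrite [LHS]mx11_scalar mul_quad_mx Qw.
rewrite linearD /= trmx1 !mulmxDl !mulmxDr !mul1mx !mulmx1 tT.
rewrite /tau !trmx_mul trmxK gram_tr !mulmxA.
have -> : gram *m w^T *m w *m quad_mx *m w^T *m w *m gram = gram *m w^T *m w *m gram.
  by rewrite -(mulmxA _ w quad_mx) -(mulmxA _ _ w^T) s mulmx1.
have -> : quad_mx^T = gram + quad_mx by rewrite -quad_mxD_tr addrAC mx_addrr add0r.
rewrite mulmxDl !mulmxDl addrC !addrA mx_addrr add0r -!addrA addrC.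
by rewrite -addrA.
Qed.

Definition perm_mx_of (g : {perm V}) : 'M[F]_N := \matrix_i g (delta_mx 0 i).

Lemma mul_perm_mx_of g : g \in isometry Q -> forall v, v *m perm_mx_of g = g v.
Proof.
case/isometryP => gl _ v; have g0 : g 0 = 0.
  by have := gl (-1) 0 0; rewrite scaler0 addr0 scaleN1r addNr.
have gD u w : g (u + w) = g u + g w by have := gl 1 u w; rewrite !scale1r.
have gZ a u : g (a *: u) = a *: g u by have := gl a u 0; rewrite !addr0 g0 addr0.
rewrite mulmx_sum_row [v in RHS]row_sum_delta (big_morph g gD g0).
by apply: eq_bigr => i _; rewrite gZ rowK.
Qed.

Lemma eq_mx_mul (A A' : 'M[F]_N) : (forall v : V, v *m A = v *m A') -> A = A'.
Proof. by move=> h; apply/row_matrixP => i; rewrite !rowE. Qed.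

Definition dickson_perm g := dickson (perm_mx_of g).

Lemma perm_mx_of_iso g : g \in isometry Q ->
  forall v, Q (v *m perm_mx_of g) = Q v.
Proof.
by move=> gO v; rewrite mul_perm_mx_of //; case/isometryP: gO.
Qed.

Lemma dickson_permM g h : g \in isometry Q -> h \in isometry Q ->
  dickson_perm (g * h)%g = dickson_perm g + dickson_perm h.
Proof.
move=> gO hO; rewrite /dickson_perm -dicksonM; try exact: perm_mx_of_iso.
congr dickson; apply: eq_mx_mul => v.
by rewrite mulmxA !mul_perm_mx_of ?groupM //= permM.
Qed.

Lemma dickson_perm_iperm M : invol M -> dickson_perm (iperm M) = dickson (1%:M + M).
Proof.
move=> MI; congr dickson; apply: eq_mx_mul => v.
by rewrite mul_perm_mx_of ?iperm_isometry // ipermE // mulmxDr mulmx1.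
Qed.

Lemma dickson_perm1 : dickson_perm 1%g = 0.
Proof. by rewrite -iperm0 dickson_perm_iperm ?invol0 // addr0 dickson1. Qed.

(** The invariant is a homomorphism to the abelian group F, so it kills commutators. *)
Lemma dickson_perm_Omega g : g \in Omega Q -> dickson_perm g = 0.
Proof.
have Kset : group_set [set h in isometry Q | dickson_perm h == 0].
  apply/group_setP; split=> [|h k]; first by rewrite inE group1 dickson_perm1 eqxx.
  rewrite inE => /andP[hO /eqP h0]; rewrite inE => /andP[kO /eqP k0].
  by rewrite inE groupM //= dickson_permM // h0 k0 addr0 eqxx.
have : Omega Q \subset Group Kset.
  rewrite /Omega derg1 gen_subG; apply/fintype.subsetP => _ /imset2P[h k hO kO ->].
  have inv x : x \in isometry Q -> dickson_perm x^-1%g = - dickson_perm x.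
    move=> xO; apply/eqP; rewrite -addr_eq0 -dickson_permM ?groupV //.
    by rewrite mulVg dickson_perm1.
  rewrite inE groupR //= commgEl conjgE.
  rewrite !dickson_permM ?groupM ?groupV //= !inv //.
  by apply/eqP; ring.
by move/fintype.subsetP => sub gO; have := sub g gO; rewrite inE => /andP[_ /eqP].
Qed.

Lemma odd_Omega (M : 'M[F]_N) : invol M ->
  (exists v, Q (v *m M) != 0) -> odd (\rank M) -> iperm M \notin Omega Q.
Proof.
move=> MI nd od; have [[s [s1 s2 e]] _] := diag_decomp MI (or_introl nd).
apply/negP => /dickson_perm_Omega; rewrite e => /eqP.
suff [-> _] : dickson_perm (\prod_(w <- s) iperm (tau w))%g = (size s)%:R /\
    (\prod_(w <- s) iperm (tau w))%g \in isometry Q.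
  by rewrite s1 -(dvdn_pcharf F2) dvdn2 od.
elim: s s2 {s1 e} => [|w s IH] s2; rewrite ?big_nil ?dickson_perm1 ?big_cons.
  by rewrite group1.
have [e1 e2] : _ /\ _ := IH (fun u us => s2 u (mem_behead (s := w :: s) us)).
have Qw : Q w = 1 by rewrite s2 ?inE ?eqxx.
have tO : iperm (tau w) \in isometry Q by rewrite iperm_isometry ?invol_tau0.
rewrite groupM //= dickson_permM // dickson_perm_iperm ?invol_tau0 // dickson_tau // e1.
by rewrite nat1r.
Qed.

(** * Counting involutions by rank *)

Lemma card_dep (T1 T2 : finType) (X : {set T1}) (D : T1 -> {set T2}) :
  #|[set p : T1 * T2 | (p.1 \in X) && (p.2 \in D p.1)]| = (\sum_(x in X) #|D x|)%N.
Proof.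
rewrite -sum1_card (eq_bigl (fun p : T1 * T2 => (p.1 \in X) && (p.2 \in D p.1))).
  by rewrite -(pair_big_dep (mem X) (fun x y => y \in D x) (fun _ _ => 1%N)) /=;
    apply: eq_bigr => x _; rewrite sum1_card.
by move=> p; rewrite inE.
Qed.

(** Translations by multiples of w carry any level set of f into any other, since an injective [phi]
    on a finite field is onto. Hence all level sets have the same size. *)
Lemma shift_card (U : {set V}) (f : V -> F) (phi : F -> F) (w : V) (a : F) :
  injective phi -> (forall u c, u \in U -> u + c *: w \in U) ->
  (forall u c, u \in U -> f (u + c *: w) = f u + phi c) ->
  (#|F| * #|[set u in U | f u == a]|)%N = #|U|.
Proof.
move=> phi_inj Uw fw; pose L b := [set u in U | f u == b].
have le b c : (#|L b| <= #|L c|)%N.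
  pose d := invF phi_inj (c - b).
  have dE : phi d = c - b by rewrite /d f_invF.
  rewrite -(card_imset (L b) (addIr (d *: w))); apply/subset_leq_card/fintype.subsetP.
  move=> _ /imsetP[u + ->]; rewrite !inE => /andP[uU /eqP fu].
  by rewrite Uw // fw // fu dE addrC subrK eqxx.
have -> : #|U| = (\sum_(b : F) #|L b|)%N.
  rewrite -sum1_card (partition_big f predT) //=; apply: eq_bigr => b _.
  by rewrite -sum1_card; apply: eq_bigl => u; rewrite inE.
rewrite (eq_bigr (fun _ => #|L a|)) ?sum_nat_const // => b _.
by apply/eqP; rewrite eqn_leq !le.
Qed.

Local Notation q := #|F|.

Definition kerset (M : 'M[F]_N) : {set V} := [set v | v *m M == 0].

Lemma card_kerset (M : 'M[F]_N) : #|kerset M| = (q ^ (N - \rank M))%N.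
Proof.
rewrite -mxrank_ker -card_rowg; apply: eq_card => v; rewrite !inE.
by apply/eqP/sub_kermxP.
Qed.

Definition nonalt_invols r : {set 'M[F]_N} :=
  [set M | [&& invol M, [exists v : V, Q (v *m M) != 0] & \rank M == r]].
Definition alt_invols r : {set 'M[F]_N} :=
  [set M | [&& invol M, [forall v : V, Q (v *m M) == 0] & \rank M == r]].

Lemma card_unit_row M : invol M -> (exists v, Q (v *m M) != 0) ->
  (q * #|[set w : V in rowg M | Q w == 1%R]|)%N = (q ^ \rank M)%N.
Proof.
move=> MI [v Qv]; have [c [c0 Qw]] := quadZV Qv; set w := c *: _ in Qw.
have wM : (w <= M)%MS by rewrite scalemx_sub ?submxMl.
rewrite -card_rowg; apply: (@shift_card _ _ (fun c => c ^+ 2) w); first exact: sqr_inj.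
  by move=> u d; rewrite !mem_rowg => uM; rewrite addmx_sub //; exact: scalemx_sub.
move=> u d; rewrite !mem_rowg => uM.
by rewrite quadD quadZ Qw mulr1 polarZr (invol_sub_iso MI) // mulr0 addr0.
Qed.

Lemma card_unit_ker M : invol M -> (exists v, Q (v *m M) != 0) ->
  (q * #|[set w in kerset M | Q w == 1%R]|)%N = (q ^ (N - \rank M))%N.
Proof.
move=> MI [v Qv]; have [c [c0 Qw]] := quadZV Qv; set w := c *: _ in Qw.
have wM : (w <= M)%MS by rewrite scalemx_sub ?submxMl.
rewrite -card_kerset; apply: (@shift_card _ _ (fun c => c ^+ 2) w); first exact: sqr_inj.
  move=> u d; rewrite !inE => /eqP uM.
  by rewrite mulmxDl -scalemxAl (invol_sub MI wM) uM scaler0 addr0.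
move=> u d; rewrite !inE => /eqP uM.
by rewrite quadD quadZ Qw mulr1 polarZr (invol_ker_perp MI) // mulr0 addr0.
Qed.

Lemma invol_rank M : invol M -> (\rank M <= N - \rank M)%N.
Proof.
by case/involP => MM _; rewrite -mxrank_ker; apply/mxrankS/sub_kermxP.
Qed.

(** Double counting through the involutive map (M, w) |-> (M + tau w, w). From rank r + 1, w runs
    over the vectors of the image with Q = 1, except the diagonal vector, which is among them only
    for r + 1 odd. From rank r, w runs over the vectors with Q = 1 in the kernel but not in the
    image. *)
Lemma card_nonalt_invols_rec r : (0 < r)%N ->
  (#|nonalt_invols r.+1| * (q ^ r - odd r.+1) = #|nonalt_invols r| * (q ^ (N - r).-1 - q ^ r.-1))%N.
Proof.
move=> r0.
pose D M := [set w : V | [&& w \in [set w : V in rowg M | Q w == 1%R]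
  & [exists u : V, Q (u *m (M + tau w)) != 0]]].
pose E M := [set w in kerset M | Q w == 1%R] :\: [set w : V in rowg M | Q w == 1%R].
have cD M : M \in nonalt_invols r.+1 -> #|D M| = (q ^ r - odd r.+1)%N.
  rewrite inE => /and3P[MI /existsP nd /eqP rM].
  have c1 : #|[set w : V in rowg M | Q w == 1%R]| = (q ^ r)%N.
    apply/eqP; rewrite -(eqn_pmul2l (ltnW (finNzRing_gt1 F))) card_unit_row // rM.
    by rewrite expnS.
  have [_ [w0 [w0M bw0 Qw0]]] := diag_decomp MI (or_introl nd).
  rewrite -c1 -(cardsID [set w0] [set w : V in rowg M | Q w == 1%R]).
  have -> : [set w : V in rowg M | Q w == 1%R] :\: [set w0] = D M.
    apply/setP => w; rewrite inE [RHS]inE andbC; apply: andb_id2l.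
    rewrite !inE => /andP[wM /eqP Qw].
    apply/negP/idP => [ww0|/existsP[u Qu]]; last first.
      move/eqP => ww0; case/negP: Qu; apply/eqP; move: u.
      by apply/(diag_vector_tau MI (invol_sub MI wM) Qw); rewrite ww0.
    apply: contraT; rewrite negb_exists => /forallP h; case: ww0; apply/eqP.
    apply: (diag_vector_uniq _ bw0); apply/(diag_vector_tau MI (invol_sub MI wM) Qw) => u.
    by have := h u; rewrite negbK => /eqP.
  suff -> : #|[set w : V in rowg M | Q w == 1%R] :&: [set w0]| = odd r.+1.
    by rewrite addKn.
  have Qo : (Q w0 == 1) = odd r.+1.
    rewrite Qw0 rM; case: odd (odd_double_half r.+1) => <-; rewrite ?add1n ?add0n.
      by rewrite -natr1 -mul2n natrM (pcharf0 F2) mul0r add0r eqxx.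
    by rewrite -mul2n natrM (pcharf0 F2) mul0r eq_sym oner_eq0.
  rewrite -Qo; case Qw: (Q w0 == 1).
    apply/eqP/cards1P; exists w0; apply/setP => w; rewrite !inE andbC.
    by case: eqP => // ->; rewrite w0M Qw.
  apply/eqP; rewrite cards_eq0; apply/eqP/setP => w; rewrite !inE.
  by case: (w =P w0) => [->|]; rewrite ?andbF // Qw andbF.
have cE M : M \in nonalt_invols r -> #|E M| = (q ^ (N - r).-1 - q ^ r.-1)%N.
  rewrite inE => /and3P[MI /existsP nd /eqP rM].
  have rN : (0 < N - r)%N by have := invol_rank MI; rewrite rM; lia.
  rewrite cardsDS; last first.
    apply/fintype.subsetP => w; rewrite !inE => /andP[wM ->].
    by rewrite (invol_sub MI wM) eqxx.
  congr (_ - _)%N; apply/eqP; rewrite -(eqn_pmul2l (ltnW (finNzRing_gt1 F))).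
    by rewrite card_unit_ker // rM -expnS prednK.
  by rewrite card_unit_row // rM -expnS prednK.
rewrite -[LHS]sum_nat_const -[RHS]sum_nat_const -(eq_bigr _ cD) -(eq_bigr _ cE).
rewrite -!card_dep.
pose f (p : 'M[F]_N * V) := (p.1 + tau p.2, p.2).
have ff : involutive f by case=> M w; rewrite /f /= tauK.
have f1 p : p \in [set p | (p.1 \in nonalt_invols r.+1) && (p.2 \in D p.1)] ->
    f p \in [set p | (p.1 \in nonalt_invols r) && (p.2 \in E p.1)].
  case: p => M w; rewrite !inE /= => /andP[/and3P[MI nd /eqP rM]].
  move=> /andP[/andP[wM /eqP Qw] nd'].
  have [wM' wM0 rM'] := tau_notin MI wM Qw.
  rewrite invol_tau ?(invol_sub MI) //= nd' wM0 eqxx Qw eqxx !andbT.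
  by rewrite wM' /= andbT -eqSS -rM' rM.
have f2 p : p \in [set p | (p.1 \in nonalt_invols r) && (p.2 \in E p.1)] ->
    f p \in [set p | (p.1 \in nonalt_invols r.+1) && (p.2 \in D p.1)].
  case: p => M w; rewrite !inE /= => /andP[/and3P[MI nd /eqP rM]].
  move=> /andP[wM /andP[/eqP wM0 /eqP Qw]]; rewrite Qw eqxx andbT in wM.
  have [wM' rM'] := tau_rank MI wM.
  rewrite invol_tau //= rM' rM eqxx wM' Qw eqxx tauK nd !andbT.
  case/submxP: wM' => u uE; apply/existsP; exists u; rewrite -uE Qw.
  exact: oner_neq0.
apply/eqP; rewrite eqn_leq; apply/andP; split.
  rewrite -(card_imset _ (inv_inj ff)); apply/subset_leq_card/fintype.subsetP.
  by move=> _ /imsetP[p pP ->]; exact: f1.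
rewrite -(card_imset _ (inv_inj ff)); apply/subset_leq_card/fintype.subsetP.
by move=> _ /imsetP[p pP ->]; exact: f2.
Qed.

Lemma card_nonalt_invols1 : #|nonalt_invols 1| = #|[set w : V | Q w == 1]|.
Proof.
have -> : nonalt_invols 1 = [set tau w | w in [set w : V | Q w == 1]].
  apply/setP => M; rewrite inE; apply/and3P/imsetP => [[MI /existsP[v Qv] /eqP rM]|].
    have [w [wM Qw _]] := exists_splitting MI Qv; exists w; first by rewrite inE Qw.
    have [_ _] := tau_notin MI wM Qw; rewrite rM => -[/esym/eqP].
    rewrite mxrank_eq0 => /eqP e.
    by rewrite -(tauK M w) e add0r.
  case=> w; rewrite inE => /eqP Qw ->.
  have wn : ~~ (w <= (0 : 'M[F]_N))%MS.
    apply/negP; rewrite submx0 => /eqP w0; move/eqP: Qw.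
    by rewrite w0 quad0 eq_sym oner_eq0.
  have [wt] := tau_rank invol0 wn; rewrite add0r mxrank0 => rt.
  rewrite invol_tau0 // rt; split=> //; apply/existsP.
  rewrite add0r in wt; case/submxP: wt => u uE; exists u.
  by rewrite -uE Qw oner_neq0.
apply: card_in_imset => w w'; rewrite !inE => /eqP Qw /eqP Qw' e.
(* w is recovered from [tau w] as its diagonal vector. *)
apply: (@diag_vector_uniq (tau w)) => u; first by rewrite mul_tau polarZr expr2.
by rewrite e mul_tau polarZr expr2.
Qed.

Lemma alt_invols_quad0 M (r : nat) (w : V) : M \in alt_invols r -> (w <= M)%MS -> Q w = 0.
Proof.
rewrite inE => /and3P[_ /forallP h _] /submxP[u ->].
by apply/eqP; exact: h.
Qed.

Lemma card_level_sum (U : {set V}) (g : F -> nat) :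
  (\sum_(u in U) g (Q u) = \sum_c #|[set u in U | Q u == c]| * g c)%N.
Proof.
rewrite (partition_big Q predT) //=; apply: eq_bigr => c _.
rewrite -sum_nat_const; apply: eq_big => [u|u /andP[_ /eqP->]//].
by rewrite inE.
Qed.

(* Double counting of the pairs (v, w) of ker M with Q v = Q w; the substitution
   x = v + w turns the condition into B(x, v) = Q x, which is linear in v. *)
Lemma second_moment M (r : nat) : M \in alt_invols r ->
  let u := #|kerset M| in let a := #|[set w in kerset M | Q w == 1%R]| in
  ((u%:Z - (q * a)%N%:Z) ^+ 2 = (q ^ r * u)%N%:Z)%R.
Proof.
move=> MA u a; have := MA; rewrite inE => /and3P[MI _ /eqP rM].
set U := kerset M in u a *.
pose L c := #|[set w in U | Q w == c]|.
have UZ c (w : V) : w \in U -> c *: w \in U.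
  by rewrite !inE -scalemxAl => /eqP->; rewrite scaler0.
have UD (v w : V) : v \in U -> w \in U -> v + w \in U.
  by rewrite !inE mulmxDl => /eqP-> /eqP->; rewrite addr0.
(* Every element of F is a square, so rescaling identifies the level sets of all nonzero values. *)
have Lc c : c != 0 -> L c = a.
  have le (b d : F) : b != 0 -> d != 0 -> (L b <= L d)%N.
    move=> b0 d0; have [e eE] := sqrt_exists (d / b).
    have e0 : e != 0 by rewrite -sqrf_eq0 eE mulf_neq0 ?invr_eq0.
    rewrite /L -(card_imset [set w in U | Q w == b] (can_inj (scalerK e0))).
    apply/subset_leq_card/fintype.subsetP => _ /imsetP[w + ->].
    rewrite inE => /andP[wU /eqP Qw]; rewrite inE UZ //= quadZ Qw eE.
    by rewrite divfK.
  by move=> c0; apply/eqP; rewrite eqn_leq !le ?oner_neq0.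
have card_nz : #|[pred c : F | c != 0]| = q.-1.
  by rewrite -(cardC1 0); apply: eq_card => c; rewrite !inE.
have E1 : (L 0%R + q.-1 * a = u)%N.
  have := card_level_sum U (fun _ => 1%N); rewrite sum1_card -/u => ->.
  rewrite (bigD1 0%R) //= muln1 (eq_bigr (fun _ => a)); last by move=> c c0; rewrite muln1 -(Lc c).
  by rewrite sum_nat_const card_nz.
have E2 : (\sum_(v in U) L (Q v) = L 0%R * L 0%R + q.-1 * (a * a))%N.
  rewrite card_level_sum (bigD1 0) //= (eq_bigr (fun _ => a * a)%N); last first.
    by move=> c c0; rewrite -/(L c) Lc.
  by rewrite sum_nat_const card_nz.
have E3 : (\sum_(v in U) L (Q v) = \sum_(x in U) #|[set v in U | B x v == Q x]|)%N.
  have cb (S : pred V) : #|[set w in U | S w]| = (\sum_(w in U) S w)%N.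
    rewrite -sum1_card big_mkcond [RHS]big_mkcond /=.
    by apply: eq_bigr => w _; rewrite inE; case: (w \in U); case: (S w).
  under eq_bigr do rewrite /L cb.
  under [RHS]eq_bigr do rewrite cb.
  rewrite [RHS]exchange_big /=; apply: eq_bigr => v vU.
  rewrite (reindex_inj (addIr v)) /=; apply: eq_big => [x|x _].
    apply/idP/idP => [xv|xU]; last exact: UD.
    by rewrite -[x]addr0 -(mx_addrr v) addrA UD.
  rewrite quadD addrAC -subr_eq0 addrK addrC.
  by rewrite -[Q x](oppr_pchar2 F2) subr_eq0 oppr_pchar2.
(* For x in the image both B(x, v) and Q(x) are 0 and every v of the kernel counts; otherwise B(x,
   -) is a nonzero linear form on the kernel. *)
have E4 x : x \in U ->
    (q * #|[set v in U | B x v == Q x]| = if (x <= M)%MS then q * u else u)%N.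
  move=> xU; case: ifPn => [xM|/(invol_notin MI)[v [vM vx]]].
    congr (_ * _)%N; apply: eq_card => v; rewrite !inE.
    case: eqP => //= vM; rewrite (alt_invols_quad0 MA xM) polarC.
    by rewrite (invol_ker_perp MI) ?eqxx.
  rewrite /u -(@shift_card U (B x) id v (Q x)) // => [w c wU|w c wU].
    by rewrite UD ?UZ // inE vM.
  by rewrite polarDr polarZr (polarC x v) vx mulr1.
have sub : rowg M \subset U.
  by apply/fintype.subsetP => w; rewrite !inE => wM; rewrite (invol_sub MI).
have E5 : (q * \sum_(v in U) L (Q v) = q ^ r * (q * u) + (u - q ^ r) * u)%N.
  rewrite E3 big_distrr /= (eq_bigr _ E4).
  rewrite (bigID (mem (rowg M))) /=; congr (_ + _)%N.
    rewrite (eq_bigr (fun _ => q * u)%N).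
      rewrite (eq_bigl (mem (rowg M))) ?sum_nat_const ?card_rowg ?rM // => w /=.
      by apply/andP/idP => [[]//|wM]; split=> //; exact: (fintype.subsetP sub).
    by move=> w /andP[_]; rewrite inE => ->.
  rewrite (eq_bigr (fun _ => u)); last first.
    by move=> w /andP[_]; rewrite inE => /negPf->.
  rewrite (eq_bigl (mem (U :\: rowg M))).
    by rewrite sum_nat_const cardsDS // card_rowg rM.
  by move=> w; rewrite /= finset.in_setD andbC.
have Wu : (q ^ r <= u)%N by rewrite -rM -card_rowg; exact: subset_leq_card.
move: E5; rewrite E2; have := finNzRing_gt1 F; set W := (q ^ r)%N in Wu *.
case: q E1 E2 card_nz => // k E1 _ _ k1 E5.
rewrite /= in E1 E5.
have k0 : (k%:Z != 0)%R by apply/eqP; lia.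
(* With k = q - 1 and L 0 = u - k a substituted, the pair count is k times the claimed identity. *)
apply: (mulfI k0).
have e1 : (L 0%R)%:Z = u%:Z - k%:Z * a%:Z by rewrite -E1; lia.
have : ((k.+1)%:Z * ((L 0%R)%:Z * (L 0%R)%:Z + k%:Z * (a%:Z * a%:Z)) =
  W%:Z * (k.+1%:Z * u%:Z) + (u%:Z - W%:Z) * u%:Z).
  have Wuu : (W * u <= u * u)%N by rewrite leq_mul.
  by move: E5; rewrite mulnBl; lia.
rewrite e1 !PoszM -addn1 PoszD => e2.
apply/eqP; rewrite -subr_eq0; apply/eqP.
move/eqP: e2; rewrite -subr_eq0 => /eqP <-; ring.
Qed.

(** * Upper bounds for involutions of alternating type *)

Definition alternating_type (M : 'M[F]_N) := [forall v : V, Q (v *m M) == 0].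

Lemma card_rank_sum (S : {set 'M[F]_N}) k : (forall M, M \in S -> (\rank M < k)%N) ->
  (#|S| = \sum_(r < k) #|[set M in S | \rank M == r :> nat]|)%N.
Proof.
case: k => [|k] h.
  rewrite big_ord0; apply/eqP; rewrite cards_eq0; apply/eqP/setP => M.
  by rewrite inE; apply/negP => /h.
rewrite -sum1_card (partition_big (fun M : 'M[F]_N => inord (\rank M) : 'I_k.+1) predT) //=.
apply: eq_bigr => r _; rewrite -sum1_card; apply: eq_bigl => M; rewrite inE.
apply: andb_id2l => MS; rewrite -val_eqE /= inordK ?h //.
Qed.

(* The analogue of [tau] that splits off a hyperbolic plane. *)
Definition sigma (w w' : V) : 'M[F]_N := gram *m w^T *m w' + gram *m w'^T *m w.

Lemma mul_sigma (v w w' : V) : v *m sigma w w' = B v w *: w' + B v w' *: w.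
Proof.
rewrite /sigma mulmxDr !mulmxA [v *m gram *m w^T]mx11_scalar.
by rewrite [v *m gram *m w'^T]mx11_scalar !mul_scalar_mx !polarE.
Qed.

Lemma sigma_rank (w w' : V) : (\rank (sigma w w') <= 2)%N.
Proof.
apply: leq_trans (mxrank_add _ _) _.
by rewrite (leq_add (n1 := 1) (n2 := 1)) //;
  apply: leq_trans (mxrankM_maxr _ _) (rank_leq_row _).
Qed.

(** The image of T = [M + sigma w w'] lies in that of M, and T kills the latter. Also vT = 0,
    because B(v, w) = Q(w) = 0. If the rank did not drop, w' would be in the image of T and so
    orthogonal to v, against B(v, w') = 1. *)
Lemma invol_sigma (M : 'M[F]_N) (v w' : V) (w := v *m M) :
  invol M -> alternating_type M -> (w' <= M)%MS -> B v w' = 1 ->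
  [/\ invol (M + sigma w w'), alternating_type (M + sigma w w'),
      (\rank M - 2 <= \rank (M + sigma w w')%R < \rank M)%N,
      w *m (M + sigma w w') = 0 & w' *m (M + sigma w w') = 0].
Proof.
move=> MI /forallP MA w'M vw'; have [MM QM] := involP MI.
have wM : (w <= M)%MS by exact: submxMl.
have QM0 (u : V) : (u <= M)%MS -> Q u = 0 by case/submxP => x ->; apply/eqP.
have mulE (u : V) : u *m (M + sigma w w') = u *m M + (B u w *: w' + B u w' *: w).
  by rewrite mulmxDr mul_sigma.
have sub : ((M + sigma w w')%R <= M)%MS.
  apply/row_subP => i; rewrite rowE mulE !addmx_sub ?submxMl //; exact: scalemx_sub.
have ker0 (u : V) : (u <= M)%MS -> u *m (M + sigma w w') = 0.
  move=> uM. rewrite mulE (invol_sub MI uM) !(invol_sub_iso MI uM) //.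
  by rewrite !scale0r !addr0.
have QT (u : V) : Q (u *m (M + sigma w w')) = 0.
  by rewrite QM0 // (submx_trans _ sub) ?submxMl.
have MI' : invol (M + sigma w w').
  apply/involP; split.
    by apply: eq_mx_mul => u; rewrite mulmx0 mulmxA ker0 // (submx_trans _ sub) ?submxMl.
  move=> u; rewrite QT mulE !polarDr !polarZr -QM QM0 ?submxMl // add0r.
  by rewrite mulrC addrr_pchar2.
split; [by []|by apply/forallP => u; rewrite QT| |exact: ker0|exact: ker0].
apply/andP; split.
  have := mxrank_add (M + sigma w w') (sigma w w').
  by rewrite -addrA mx_addrr addr0; have := sigma_rank w w'; lia.
apply: rank_ltmx; rewrite /ltmx sub /=; apply/negP => sup.
have w'T := submx_trans w'M sup.
have vT : v *m (M + sigma w w') = 0.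
  by rewrite mulE vw' scale1r -/w -[B v w]QM QM0 // scale0r add0r mx_addrr.
have := invol_ker_perp MI' vT w'T; rewrite vw' => /eqP.
by rewrite oner_eq0.
Qed.

(** [pinvmx M] picks a preimage of the first vector. For an involution any preimage gives the same
    condition, as ker M is orthogonal to the row space. *)
Definition hyp_pairs (M : 'M[F]_N) : {set V * V} :=
  [set p | (p.1 \in rowg M) && (p.2 \in [set w' in rowg M | B (p.1 *m pinvmx M) w' == 1])].

Lemma card_hyp_pairs (M : 'M[F]_N) : invol M ->
  #|hyp_pairs M| = ((q ^ \rank M).-1 * q ^ (\rank M).-1)%N.
Proof.
move=> MI; rewrite /hyp_pairs (card_dep (rowg M) (fun w => [set w' in rowg M | B (w *m pinvmx M) w' == 1])).
have m0 : (0 : V) \in rowg M by rewrite mem_rowg sub0mx.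
rewrite (bigD1 0) //= [X in (X + _)%N](_ : _ = 0)%N ?add0n; last first.
  apply/eqP; rewrite cards_eq0; apply/eqP/setP => w'.
  by rewrite !inE mul0mx polar0l eq_sym oner_eq0 andbF.
rewrite (eq_bigr (fun _ => q ^ (\rank M).-1)%N).
  rewrite sum_nat_const; congr (_ * _)%N.
  rewrite -card_rowg (cardD1 0 (rowg M)) m0 /=.
  by apply: eq_card => w; rewrite !inE -[LHS]/((w \in rowg M) && _) mem_rowg andbC.
move=> w /andP[]; rewrite mem_rowg => wM w0.
set v := w *m pinvmx M; have vM : v *m M = w by rewrite mulmxKpV.
have [u uw] : exists u, B u w = 1.
  have [u /eqP h] : exists u, B u w != 0.
    apply/existsP; apply: contraT; rewrite negb_exists => /forallP h.
    case/eqP: w0; apply: polar_eq0 => x; apply/eqP; have := h x; by rewrite negbK.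
  by exists ((B u w)^-1 *: u); rewrite polarZl mulVf //; apply/eqP.
apply/eqP; rewrite -(eqn_pmul2l (ltnW (finNzRing_gt1 F))) -expnS prednK; last first.
  by rewrite lt0n mxrank_eq0; apply: contraNneq w0 => M0; rewrite -submx0 -M0.
rewrite -card_rowg; apply/eqP.
apply: (@shift_card _ (B v) id (u *m M)) => // [x c|x c _].
  rewrite !mem_rowg => xM; rewrite addmx_sub //; apply: scalemx_sub.
  exact: submxMl.
by rewrite polarDr polarZr -(invol_adj MI) vM (polarC w) uw mulr1.
Qed.

Section Dim.
Variable n : nat.
Hypothesis Nn : N = (n + n)%N.

Lemma invol_rank_le M : invol M -> (\rank M <= n)%N.
Proof. by move/invol_rank; lia. Qed.

(** The square root of [second_moment]: the right-hand side there is q^N = (q^n)^2, and the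
    disjunction is the choice of sign. *)
Lemma card_unit_alt M (r : nat) : M \in alt_invols r ->
  let a := #|[set w in kerset M | Q w == 1%R]| in
  (q * a = q ^ (N - r) + q ^ n \/ q * a + q ^ n = q ^ (N - r))%N.
Proof.
move=> MA a; have := second_moment MA; rewrite /= -/a.
have /and3P[MI _ /eqP rM] : [&& invol M, [forall v : V, Q (v *m M) == 0] & \rank M == r].
  by rewrite inE in MA.
rewrite card_kerset rM -expnD subnKC; last by rewrite -rM rank_leq_row.
have -> : (q ^ N = q ^ n * q ^ n)%N by rewrite {1}Nn expnD.
rewrite (PoszM (q ^ n)%N) -expr2 => /eqP; rewrite eqf_sqr.
case/orP => /eqP; move: (q ^ (N - r))%N (q ^ n)%N (q * a)%N => x y z e; [right|left]; lia.
Qed.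

Lemma zero_alt_invols : 0 \in alt_invols 0.
Proof.
rewrite inE invol0 mxrank0 eqxx andbT; apply/forallP => v.
by rewrite mulmx0 quad0.
Qed.

Lemma card_nonalt_invols1_dim :
  (q * #|nonalt_invols 1| = q ^ (n + n) + q ^ n \/ q * #|nonalt_invols 1| + q ^ n = q ^ (n + n))%N.
Proof.
have := card_unit_alt zero_alt_invols; have -> : (N - 0 = n + n)%N by rewrite subn0.
rewrite card_nonalt_invols1 /=; suff -> : [set w in kerset 0 | Q w == 1] = [set w : V | Q w == 1] by [].
by apply/setP => w; rewrite !inE mulmx0 eqxx.
Qed.

(** (M, w) |-> M + tau w is injective, as w is the diagonal vector of the result. By [card_unit_alt]
    and N - r > n, each M admits at least q^(n-1) vectors w. *)
Lemma card_alt_invols_le r : (r < n)%N -> (#|alt_invols r| * q ^ n.-1 <= #|nonalt_invols r.+1|)%N.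
Proof.
move=> rn; pose U M := [set w in kerset M | Q w == 1].
pose P := [set p : 'M[F]_N * V | (p.1 \in alt_invols r) && (p.2 \in U p.1)].
have PE : (#|alt_invols r| * q ^ n.-1 <= #|P|)%N.
  rewrite /P (card_dep (alt_invols r) U) -sum_nat_const leq_sum // => M MA.
  have := card_unit_alt MA; rewrite /= -/(U M) => h.
  rewrite -(leq_pmul2l (ltnW (finNzRing_gt1 F))) -expnS prednK; last by lia.
  have : (q ^ n + q ^ n <= q ^ (N - r))%N.
    rewrite addnn -mul2n; apply: leq_trans (_ : q ^ n.+1 <= _)%N.
      by rewrite expnS leq_mul2r (finNzRing_gt1 F) orbT.
    by rewrite leq_exp2l ?finNzRing_gt1 //; lia.
  move: h; move: (q ^ (N - r))%N (q ^ n)%N (q * #|U M|)%N => x y z; lia.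
apply: leq_trans PE _; pose f (p : 'M[F]_N * V) := p.1 + tau p.2.
have fP p : p \in P -> [/\ invol (p.1 + tau p.2), f p \in nonalt_invols r.+1 & diag_vector (f p) p.2].
  case: p => M w; rewrite !inE /= => /andP[/and3P[MI MA /eqP rM]].
  move=> /andP[/eqP wM /eqP Qw].
  have wM' : ~~ (w <= M)%MS.
    apply/negP => /submxP[v vM]; move/forallP/(_ v)/eqP: MA.
    by rewrite -vM Qw => /eqP; rewrite oner_eq0.
  have [wf rf] := tau_rank MI wM'; have MI' := invol_tau MI wM Qw.
  rewrite /f /= MI' rf rM eqxx; split=> //.
    rewrite andbT; case/submxP: wf => v vE; apply/existsP; exists v.
    by rewrite -vE Qw oner_neq0.
  apply/(diag_vector_tau MI') => // [|v]; last by rewrite tauK; apply/eqP/(forallP MA).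
  by rewrite mulmxDr wM mul_tau polarvv scale0r addr0.
have inj : {in P &, injective f}.
  move=> p p' /fP[_ _ b] /fP[_ _ b'] e; rewrite e in b.
  have w := diag_vector_uniq b b'; case: p p' e w {b b'} => [M w] [M' w'] /= e ww.
  by rewrite /f /= -ww in e *; move/addIr: e => ->.
rewrite -(card_in_imset inj); apply/subset_leq_card/fintype.subsetP.
by move=> _ /imsetP[p /fP[_ pX _] ->].
Qed.

Definition alt_invols_low := [set M | [&& invol M, alternating_type M & (\rank M < n)%N]].

(** In rank n the kernel may contain no vector with Q = 1, so no transvection can be added. Adding
    [sigma w w'] instead lowers the rank by 1 or 2; M is recovered from the result and the pair (w,
    w'), which lies in a kernel of at most q^(n+2) elements. *)
Lemma card_alt_invols_top_le : (0 < n)%N ->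
  (#|alt_invols n| * ((q ^ n).-1 * q ^ n.-1) <= #|alt_invols_low| * (q ^ n.+2 * q ^ n.+2))%N.
Proof.
move=> n0.
pose E (M : 'M[F]_N) := finset.setX (kerset M) (kerset M).
pose T := [set M in alt_invols_low | (n - 2 <= \rank M)%N].
pose P := [set p : 'M[F]_N * (V * V) | (p.1 \in alt_invols n) && (p.2 \in hyp_pairs p.1)].
pose P' := [set p : 'M[F]_N * (V * V) | (p.1 \in T) && (p.2 \in E p.1)].
have <- : #|P| = (#|alt_invols n| * ((q ^ n).-1 * q ^ n.-1))%N.
  rewrite /P (card_dep (alt_invols n) hyp_pairs) -sum_nat_const; apply: eq_bigr => M.
  by rewrite inE => /and3P[MI _ /eqP rM]; rewrite card_hyp_pairs // rM.
apply: (@leq_trans #|P'|); last first.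
  apply: (@leq_trans (#|T| * (q ^ n.+2 * q ^ n.+2))%N).
    rewrite /P' (card_dep T E) -sum_nat_const leq_sum // => M.
    rewrite !inE => /andP[_ rM]; rewrite cardsX card_kerset.
    by apply: leq_mul; rewrite leq_exp2l ?finNzRing_gt1 //; lia.
  by rewrite leq_mul2r subset_leq_card ?orbT //; apply/fintype.subsetP => M; rewrite inE => /andP[].
pose f (p : 'M[F]_N * (V * V)) := (p.1 + sigma p.2.1 p.2.2, p.2).
have ff : involutive f by case=> M w; rewrite /f /= -addrA mx_addrr addr0.
rewrite -(card_imset _ (inv_inj ff)); apply/subset_leq_card/fintype.subsetP.
move=> _ /imsetP[[M [w w']] + ->]; rewrite !inE /=.
case/andP=> /and3P[MI MA /eqP rM] /andP[wM /andP[w'M /eqP vw']].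
have := invol_sigma (v := w *m pinvmx M) MI MA w'M vw'.
rewrite mulmxKpV // => -[-> -> /andP[r1 r2] -> ->].
by rewrite -rM r1 r2 eqxx.
Qed.

Definition alt_invols_all := [set M | invol M && alternating_type M].

Lemma card_alt_invols_all : #|alt_invols_all| = (#|alt_invols_low| + #|alt_invols n|)%N.
Proof.
rewrite -(cardsID alt_invols_low alt_invols_all); congr (_ + _)%N; apply: eq_card => M; rewrite !inE.
  by case: (invol M); case: (alternating_type M).
rewrite /alternating_type; case: (boolP (invol M)) => //= MI.
case: [forall v, _] => //=; rewrite ?andbF // andbT -leqNgt eqn_leq.
by rewrite invol_rank_le.
Qed.

Lemma card_alt_invols_low_le : (#|alt_invols_low| * q ^ n.-1 <= \sum_(r < n) #|nonalt_invols r.+1|)%N.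
Proof.
rewrite (@card_rank_sum _ n); last by move=> M; rewrite inE => /and3P[].
rewrite big_distrl /= leq_sum // => r _; apply: leq_trans (card_alt_invols_le (ltn_ord r)).
rewrite leq_mul2r subset_leq_card ?orbT //; apply/fintype.subsetP => M; rewrite !inE.
by case/andP=> /and3P[-> MA _] ->; rewrite andbT.
Qed.

Lemma card_alt_invols_all_le : (0 < n)%N ->
  (#|alt_invols_all| * q ^ n.-1 <= (1 + q ^ 6) * \sum_(r < n) #|nonalt_invols r.+1|)%N.
Proof.
move=> n0; apply: leq_trans (leq_mul (leqnn _) card_alt_invols_low_le).
rewrite mulnA leq_mul2r card_alt_invols_all mulnDl mul1n leq_add2l mulnC.
apply/orP; right.
have q0 := ltnW (finNzRing_gt1 F).
have pq k : (0 < q ^ k)%N by rewrite expn_gt0 q0.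
(* Since q^n - 1 >= q^(n-1), the ratio of top to low is at most q^(2(n+2)) / q^(2(n-1)) = q^6. *)
rewrite -(leq_pmul2r (pq (n.-1 + n.-1)%N)).
apply: (@leq_trans (#|alt_invols n| * ((q ^ n).-1 * q ^ n.-1))%N).
  rewrite leq_mul2l expnD leq_mul2r; apply/orP; right; apply/orP; right.
  have : (q ^ n.-1 < q ^ n)%N by rewrite ltn_exp2l ?finNzRing_gt1 // prednK.
  by case: (q ^ n)%N.
apply: leq_trans (card_alt_invols_top_le n0) _.
rewrite -[leqRHS]mulnA leq_mul2l -!expnD leq_exp2l ?finNzRing_gt1 //.
by apply/orP; right; lia.
Qed.


(** * Comparison with the involutions of the derived subgroup *)

Definition Omega_invols := [set M : 'M[F]_N | invol M && (iperm M \in Omega Q)].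

Lemma num_involutions_card : num_involutions (Omega Q) = #|Omega_invols|.
Proof.
have inj : {in Omega_invols &, injective iperm}.
  move=> M M'; rewrite !inE => /andP[MI _] /andP[MI' _] e.
  by apply: eq_mx_mul => v; apply: (addrI v); rewrite -!ipermE // e.
rewrite /num_involutions -(card_in_imset inj); apply: eq_card => g.
rewrite inE; apply/andP/imsetP => [[gO /eqP g2]|[M + ->]]; last first.
  rewrite inE => /andP[MI ->]; split=> //; apply/eqP/permP => v.
  rewrite expgS expg1 permM perm1 !ipermE // mulmxDl (mulMM MI) addr0.
  by rewrite -addrA mx_addrr addr0.
have giso : g \in isometry Q by apply: fintype.subsetP gO; rewrite /Omega der_sub.
pose M := perm_mx_of g + 1%:M.
have vM v : v *m M = g v + v by rewrite mulmxDr mulmx1 mul_perm_mx_of.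
have gg v : g (g v) = v by rewrite -permM -[(g * g)%g]/(g ^+ 2)%g g2 perm1.
have /isometryP[_ gQ] := giso.
have MI : invol M.
  apply/involP; split=> [|v].
    by apply: eq_mx_mul => v; rewrite mulmx0 mulmxA (vM v) mulmxDl !vM gg (addrC v) mx_addrr.
  by rewrite vM quadD gQ addrr_pchar2 // add0r polarDr polarvv addr0 polarC.
have ipM : iperm M = g.
  by apply/permP => v; rewrite ipermE // vM addrC -addrA mx_addrr addr0.
by exists M; rewrite ?ipM // inE MI ipM.
Qed.

(** Outside the alternating type, membership in [Omega Q] is decided by the parity of the rank.
    Involutions of alternating type are left undecided and make up the gap between the bounds. *)
Lemma num_involutions_bounds : (2 < n)%N ->
  (\sum_(r < n.+1 | ~~ odd r) #|nonalt_invols r| <= num_involutions (Omega Q)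
     <= \sum_(r < n.+1 | ~~ odd r) #|nonalt_invols r| + #|alt_invols_all|)%N.
Proof.
move=> n2; rewrite num_involutions_card; set K := (\sum_(r < _ | _) _)%N.
pose E := [set M : 'M[F]_N | [&& invol M, ~~ alternating_type M & ~~ odd (\rank M)]].
have ndP M : ~~ alternating_type M -> exists v, Q (v *m M) != 0.
  by rewrite negb_forall => /existsP.
have N4 : (4 < N)%N by rewrite Nn; lia.
have KE : K = #|E|.
  rewrite (@card_rank_sum E n.+1); last first.
    by move=> M; rewrite inE => /andP[MI _]; rewrite ltnS invol_rank_le.
  rewrite [RHS](bigID (fun r : 'I__ => ~~ odd r)) /=.
  rewrite [X in (_ + X)%N]big1 ?addn0 => [|r /negPn od].
    apply: eq_bigr => r od; apply: eq_card => M; rewrite !inE negb_forall.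
    by case: eqP => [->|]; rewrite ?andbF // od !andbT.
  apply/eqP; rewrite cards_eq0; apply/eqP/setP => M; rewrite !inE.
  by case: eqP => [->|]; rewrite ?andbF // od !andbF.
have EO : E \subset Omega_invols.
  apply/fintype.subsetP => M; rewrite !inE => /and3P[MI nd od]; rewrite MI even_Omega //.
  exact: ndP.
rewrite KE subset_leq_card //=.
apply: leq_trans (leq_card_setU E alt_invols_all); apply/subset_leq_card/fintype.subsetP => M.
rewrite !inE => /andP[MI MO]; rewrite MI /=.
have [|nd] := boolP (alternating_type M); rewrite ?orbT // orbF /=.
by apply: contraL MO => od; apply: odd_Omega => //; exact: ndP.
Qed.

End Dim.
End Forms.

(** * Asymptotics of the recursion *)

Section Estimates.
Variables (R : realFieldType) (q : nat).
Hypothesis q_gt1 : (1 < q)%N.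
Local Notation t := (q%:R^-1 : R).
Local Notation p := (t ^+ 2).

Let q0 : (0 : R) < q%:R. Proof. by rewrite ltr0n; lia. Qed.
Let qN0 : (q%:R : R) != 0. Proof. by rewrite gt_eqF. Qed.
Let t0 : 0 < t. Proof. by rewrite invr_gt0. Qed.
Let t1 : t <= 2^-1.
Proof. by rewrite lef_pV2 ?posrE // ler_nat. Qed.
Let t_ge0 : 0 <= t. Proof. exact: ltW. Qed.
Let tle1 : t <= 1. Proof. by apply: (le_trans t1); lra. Qed.
Let p0 : 0 < p. Proof. by rewrite exprn_gt0. Qed.
Let p1 : p <= 4^-1.
Proof. by rewrite expr2; have := t0; have := t1; nra. Qed.

Let p_ge0 : 0 <= p. Proof. exact: ltW. Qed.
Let p_le1 : p <= 1. Proof. by apply: (le_trans p1); lra. Qed.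

(** * Pochhammer products and the finite Euler identity *)

(** The q-Pochhammer symbol (p; p)_k with p = q^-2. *)
Definition poch (k : nat) : R := \prod_(1 <= i < k.+1) (1 - p ^+ i).

Lemma poch0 : poch 0 = 1.
Proof. by rewrite /poch big_geq. Qed.

Lemma pochS k : poch k.+1 = poch k * (1 - p ^+ k.+1).
Proof. by rewrite /poch big_nat_recr. Qed.

Lemma expr_p_le k : 0 < p ^+ k.+1 /\ p ^+ k.+1 <= 4^-1.
Proof.
split; first by rewrite exprn_gt0.
rewrite exprS; have : 0 < p ^+ k by rewrite exprn_gt0.
have : p ^+ k <= 1 by exact: exprn_ile1.
by have := p0; have := p1; nra.
Qed.

Lemma poch_gt0 k : 0 < poch k.
Proof.
elim: k => [|k IH]; first by rewrite poch0.
by rewrite pochS mulr_gt0 // subr_gt0; have := expr_p_le k; lra.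
Qed.

Lemma poch_ge0 k : 0 <= poch k.
Proof. exact/ltW/poch_gt0. Qed.

Lemma poch_le a m : (a <= m)%N -> poch m <= poch a.
Proof.
move/subnK <-; elim: (m - a)%N => // k IH; rewrite addSn pochS.
have h := expr_p_le (k + a).
by apply: le_trans IH; rewrite ler_piMr ?poch_ge0 //; lra.
Qed.

Lemma poch_ge a m : (a <= m)%N -> poch a * (1 - 2 * p ^+ a.+1) <= poch m.
Proof.
move/subnK <-; set k := (m - a)%N.
(* The extra summand makes the induction on k go through: each new factor 1 - c, with c = p^(k+a+1),
   costs less than the decrease of 2c, because p <= 1/4. *)
suff : poch a * (1 - 2 * p ^+ a.+1 + 2 * p ^+ (k + a).+1) <= poch (k + a).
  apply: le_trans; rewrite ler_wpM2l ?poch_ge0 //.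
  by have := expr_p_le (k + a); lra.
elim: k => [|k IH]; first by rewrite subrK mulr1.
rewrite addSn pochS.
have [c0 c1] := expr_p_le (k + a); have [d0 d1] := expr_p_le a.
have cS : p ^+ (k + a).+2 = p * p ^+ (k + a).+1 by rewrite exprS.
rewrite {}cS; move: IH c0 c1; set c := p ^+ (k + a).+1 => IH c0 c1.
apply: (@le_trans _ _ (poch a * (1 - 2 * p ^+ a.+1 + 2 * c) * (1 - c))); last first.
  by rewrite ler_wpM2r //; lra.
rewrite -mulrA ler_wpM2l ?poch_ge0 //.
have ca : c <= p ^+ a.+1.
by rewrite /c -addnS exprD ler_piMl ?exprn_ile1 ?exprn_ge0.
have pc : p * c <= 4^-1 * c by rewrite ler_wpM2r // ltW.
nra.
Qed.

Lemma poch_ge2 k : 2^-1 <= poch k.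
Proof.
have := poch_ge (leq0n k); rewrite poch0 expr1.
by have := p1; lra.
Qed.

(** The Gaussian binomial coefficient with base p. *)
Definition gauss (n j : nat) : R := poch n / (poch j * poch (n - j)).

(** Induction on n by the q-Pascal rule [n+1, j+1] = [n, j+1] + p^(n-j) [n, j], the exponents of t
    matching since j^2 + 2n + 1 = (j+1)^2 + 2(n-j). *)
Lemma euler_finite (z : R) n :
  \prod_(1 <= i < n.+1) (1 + z * t ^+ (2 * i - 1))
  = \sum_(j < n.+1) z ^+ j * t ^+ (j ^ 2)%N * gauss n j.
Proof.
have P0 k : poch k != 0 by rewrite gt_eqF ?poch_gt0.
have g0 m : gauss m 0 = 1 by rewrite /gauss poch0 mul1r subn0 divff.
have gn m : gauss m m = 1 by rewrite /gauss subnn poch0 mulr1 divff.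
elim: n => [|n IH].
  by rewrite big_geq // big_ord_recl big_ord0 g0 expr0 !mulr1 addr0.
rewrite big_nat_recr //= {}IH mulrDr mulr1.
rewrite [in RHS]big_ord_recl /= [in RHS]big_ord_recr /=.
rewrite [X in X + _ = _]big_ord_recl [X in _ + X * _ = _]big_ord_recr /=.
rewrite !g0 /bump /= !add1n !gn mulrDl addrACA -addrA; congr (_ + _).
rewrite mulr_suml addrA; congr (_ + _); last first.
  rewrite !mulr1 mulrACA -exprSr -exprD; congr (_ * t ^+ _).
  by clear; lia.
rewrite -big_split /=; apply: eq_bigr => [[j jn] _] /=; rewrite add1n.
have -> : z ^+ j * t ^+ (j ^ 2)%N * gauss n j * (z * t ^+ (2 * n.+1 - 1)) =
          z ^+ j.+1 * (t ^+ (j.+1 ^ 2)%N * (p ^+ (n - j) * gauss n j)).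
  have -> : t ^+ (j.+1 ^ 2)%N * (p ^+ (n - j) * gauss n j) =
            t ^+ (j ^ 2)%N * t ^+ (2 * n.+1 - 1) * gauss n j.
    rewrite mulrA -exprM -!exprD; congr (t ^+ _ * _).
    clear - jn; nia.
  by rewrite exprSr; ring.
have E1 : poch (n - j) = poch (n - j.+1) * (1 - p ^+ (n - j)).
  rewrite subnS -[in LHS](prednK (_ : 0 < n - j)%N) ?pochS ?prednK //; clear - jn; lia.
have E2 : p ^+ n.+1 = p ^+ (n - j) * p ^+ j.+1 by rewrite -exprD; congr (_ ^+ _); clear - jn; lia.
rewrite /gauss subSS !pochS E2 E1.
have nz k : 1 - p ^+ k.+1 != 0 by have := expr_p_le k; lra.
have := nz j; have := nz (n - j).-1; rewrite prednK; last by clear - jn; lia.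
move: (P0 j) (P0 (n - j.+1)%N) (p ^+ (n - j)) (p ^+ j.+1) => j0 k0 u v u0 v0.
by field; rewrite j0 k0 u0 v0.
Qed.

(** * Solving the recursion with explicit error terms *)

Section Asymptotics.
Variables (n : nat) (x : nat -> nat).
Hypothesis n_gt0 : (0 < n)%N.
Hypothesis x0 : x 0 = 0%N.
Hypothesis x1 : (q * x 1 = q ^ (n + n) + q ^ n \/ q * x 1 + q ^ n = q ^ (n + n))%N.
Hypothesis xS : forall r, (0 < r < n)%N ->
  (x r.+1 * (q ^ r - odd r.+1) = x r * (q ^ (n + n - r).-1 - q ^ r.-1))%N.

(** The normalisation by q^(r(2n - r)) makes [z r] bounded; moreover r(2n - r) = n^2 - (n - r)^2. *)
Let z r : R := (x r)%:R * t ^+ (r * (2 * n - r))%N.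

Let tq k : t ^+ k * q%:R ^+ k = 1.
Proof. by rewrite -exprMn mulVf // expr1n. Qed.

Lemma z1_bound : `|z 1 - 1| <= t ^+ n.
Proof.
have E : z 1 - 1 = (q%:R * (x 1)%:R - q%:R ^+ (n + n)) * t ^+ (n + n).
  rewrite mulrBl (mulrC (q%:R ^+ _)) tq /z mul1n; congr (_ - _).
  have -> : (n + n = (2 * n - 1).+1)%N by clear - n_gt0; lia.
  by rewrite exprS; field.
have -> : t ^+ n = q%:R ^+ n * t ^+ (n + n).
  by rewrite exprD mulrA (mulrC (q%:R ^+ n)) tq mul1r.
rewrite E normrM [`|t ^+ _|]ger0_norm ?exprn_ge0 //.
rewrite ler_wpM2r ?exprn_ge0 // -!natrX -natrM.
case: x1 => [->|<-]; rewrite natrD.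
  by rewrite addrAC subrr add0r ger0_norm.
by rewrite opprD addrA subrr add0r normrN ger0_norm.
Qed.

Lemma zS r : (0 < r < n)%N ->
  z r.+1 * (1 - (odd r.+1)%:R * t ^+ r) = z r * (1 - p ^+ (n - r)).
Proof.
move=> rn; have := congr1 (fun k : nat => k%:R : R) (xS rn).
rewrite !natrM !natrB; last 2 first.
- by rewrite leq_exp2l //; clear - rn; lia.
- by apply: leq_trans (leq_b1 _) _; rewrite expn_gt0 ltnW.
rewrite !natrX => e; rewrite /z.
have -> : (r.+1 * (2 * n - r.+1) = r * (2 * n - r) + (n + n - r).-1 - r)%N by clear - rn; nia.
have le : (r <= r * (2 * n - r) + (n + n - r).-1)%N by clear - rn; nia.
have qr : q%:R ^+ r * t ^+ r = 1 by rewrite mulrC tq.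
have -> : t ^+ (r * (2 * n - r) + (n + n - r).-1 - r) =
   q%:R ^+ r * (t ^+ (r * (2 * n - r)) * t ^+ (n + n - r).-1).
  by rewrite -exprD -{2}(subnK le) exprD [RHS]mulrCA qr mulr1.
have -> : (x r.+1)%:R *
  (q%:R ^+ r * (t ^+ (r * (2 * n - r)) * t ^+ (n + n - r).-1)) *
  (1 - (odd r.+1)%:R * t ^+ r) =
  ((x r.+1)%:R * (q%:R ^+ r - (odd r.+1)%:R * (q%:R ^+ r * t ^+ r)))
   * (t ^+ (r * (2 * n - r)) * t ^+ (n + n - r).-1) by ring.
rewrite qr mulr1 e.
have e1 : t ^+ (n + n - r).-1 * q%:R ^+ (n + n - r).-1 = 1 by rewrite tq.
have e2 : t ^+ (n + n - r).-1 * q%:R ^+ r.-1 = p ^+ (n - r).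
  rewrite -exprM; have -> : ((n + n - r).-1 = 2 * (n - r) + r.-1)%N by clear - rn; lia.
  by rewrite exprD -mulrA tq mulr1.
transitivity ((x r)%:R * t ^+ (r * (2 * n - r)) *
  (t ^+ (n + n - r).-1 * q%:R ^+ (n + n - r).-1
   - t ^+ (n + n - r).-1 * q%:R ^+ r.-1)); first by ring.
by rewrite e1 e2.
Qed.

(** Telescoping of [zS]. The factors 1 - p^(n-i) account for [poch (n - r)]; the factors 1 - t^i
    occur for even i only, where t^i = p^(i/2), and multiply to [poch r.-1./2]. *)
Lemma z_formula r : (0 < r <= n)%N ->
  z r * (poch r.-1./2 * poch (n - r)) = z 1 * poch n.-1.
Proof.
elim: r => // r IH rn; case: r IH rn => [|r] IH rn.
  by rewrite /= poch0 mul1r subn1.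
rewrite -IH; last by clear - rn; lia.
have rn' : (0 < r.+1 < n)%N by clear - rn; lia.
have := zS rn'; have -> : poch (n - r.+1) = poch (n - r.+2) * (1 - p ^+ (n - r.+1)).
  by rewrite -[in LHS](prednK (_ : 0 < n - r.+1)%N) ?pochS ?prednK ?subnS //; clear - rn; lia.
have -> : poch r.+2.-1./2 = poch r./2 * (1 - (odd r.+2)%:R * t ^+ r.+1).
  rewrite /= negbK uphalf_half; case ro: (odd r); last by rewrite add0n mul0r subr0 mulr1.
  rewrite add1n pochS mul1r -exprM; congr (_ * (1 - t ^+ _)).
  by have := odd_double_half r; rewrite ro; clear; lia.
rewrite [r.+1.-1]/=; set o := (odd _)%:R * _; set c := p ^+ (n - _) => e.
transitivity (z r.+2 * (1 - o) * (poch r./2 * poch (n - r.+2))); first by ring.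
by rewrite e; ring.
Qed.

Lemma z_bound r : (0 < r <= n)%N ->
  z r <= 4 /\ `|z r - gauss n (n - r)| <= 6 * t ^+ r.
Proof.
move=> rn; set h := r.-1./2.
have zE : z r = z 1 * (poch n.-1 / poch h) / poch (n - r).
  have := z_formula rn; rewrite -/h !mulrA => <-.
  by field; rewrite !gt_eqF ?poch_gt0.
have gE : gauss n (n - r) = (poch n / poch r) / poch (n - r).
  rewrite /gauss subKn; last by case/andP: rn.
  by rewrite invfM mulrCA [RHS]mulrC.
have ratio a m : (a <= m)%N -> 1 - 2 * p ^+ a.+1 <= poch m / poch a <= 1.
  move=> am; rewrite ler_pdivlMr ?poch_gt0 // ler_pdivrMr ?poch_gt0 // mul1r.
  by rewrite poch_le // andbT mulrC poch_ge.
have pt a : (r <= 2 * a)%N -> p ^+ a <= t ^+ r.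
  by move=> ra; rewrite -exprM ler_wiXn2l.
have := ratio h n.-1; have := ratio r n.
set u := poch n.-1 / _ in zE *; set v := poch n / _ in gE *.
move=> /(_ (proj2 (andP rn))) /andP[v1 v2].
have hn : (h <= n.-1)%N by rewrite /h; clear - rn; lia.
move=> /(_ hn) /andP[u1 u2].
have ph : p ^+ h.+1 <= t ^+ r by apply: pt; rewrite /h; clear - rn; lia.
have pr : p ^+ r.+1 <= t ^+ r by apply: pt; clear; lia.
have tn : t ^+ n <= t ^+ r by rewrite ler_wiXn2l //; case/andP: rn.
have tr0 : 0 <= t ^+ r by rewrite exprn_ge0.
have tr1 : t ^+ r <= 2^-1.
  case: (r) rn => // k _; rewrite exprS.
  by apply: le_trans t1; rewrite ler_piMr // exprn_ile1.
have := z1_bound; rewrite ler_norml => /andP[z1 z2].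
have P2 := poch_ge2 (n - r).
have Pi : 0 <= (poch (n - r))^-1 <= 2.
  by rewrite invr_ge0 poch_ge0 /= -[leRHS]invrK lef_pV2 ?posrE ?poch_gt0 ?invr_gt0.
move: Pi zE gE; set w := _^-1 => /andP[w0 w2] -> ->.
have u0 : 0 <= u by rewrite /u mulr_ge0 ?invr_ge0 ?poch_ge0.
have zu : z 1 * u <= 2 by nra.
split; first by nra.
rewrite -mulrBl normrM (ger0_norm w0).
(* z 1 is within t^r of 1, while u and v lie between 1 - 2 t^r and 1. The factor w <= 2 then doubles
   the constant to 6. *)
have : `|z 1 * u - v| <= 3 * t ^+ r.
  rewrite ler_norml; apply/andP; split; nra.
have := normr_ge0 (z 1 * u - v); nra.
Qed.

Lemma texp r : (r <= n)%N -> t ^+ (n ^ 2)%N = t ^+ (r * (2 * n - r))%N * t ^+ ((n - r) ^ 2)%N.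
Proof.
by move=> rn; rewrite -exprD; congr (_ ^+ _); rewrite -{1 3}(subnK rn); clear - rn; nia.
Qed.

Lemma sum_approx :
  `|(\sum_(r < n.+1 | ~~ odd r) x r)%N%:R * t ^+ (n ^ 2)%N -
    \sum_(r < n.+1 | ~~ odd r) t ^+ ((n - r) ^ 2)%N * gauss n (n - r)|
    <= 6 * n.+1%:R * t ^+ n.
Proof.
rewrite natr_sum mulr_suml -sumrB.
apply: le_trans (ler_norm_sum _ _ _) _.
apply: (@le_trans _ _ (\sum_(r < n.+1) 6 * t ^+ n)); last first.
  by rewrite sumr_const card_ord -[_ *+ n.+1]mulr_natr mulrAC.
rewrite big_mkcond; apply: ler_sum => -[r rn] _ /=.
have tn0 : 0 <= t ^+ n by rewrite exprn_ge0.
case: ifP => _; last by rewrite mulr_ge0.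
rewrite (@texp r) // mulrA -/(z r) mulrC -mulrBr normrM ger0_norm ?exprn_ge0 //.
have sq k : (k <= k ^ 2)%N by clear; nia.
(* Rank 0 contributes nothing to the count, and its term t^(n^2) in the approximating sum is itself
   within the error. For r > 0, (n - r)^2 + r >= n. *)
case: r rn => [|r] rn.
  rewrite subn0 /z x0 mul0r sub0r normrN /gauss subnn poch0 mulr1.
  rewrite divff ?gt_eqF ?poch_gt0 // normr1 mulr1.
  apply: (@le_trans _ _ (t ^+ n)); first by rewrite ler_wiXn2l.
  by rewrite ler_peMl //; lra.
have [_ zb] := @z_bound r.+1 rn.
apply: le_trans (ler_wpM2l _ zb) _; first by rewrite exprn_ge0.
rewrite mulrCA ler_wpM2l // -exprD ler_wiXn2l //.
by have := sq (n - r.+1)%N; clear - rn; lia.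
Qed.

Lemma sum_bound :
  (\sum_(r < n) x r.+1)%N%:R * t ^+ (n ^ 2)%N <= 4 * n%:R.
Proof.
rewrite natr_sum mulr_suml.
apply: (@le_trans _ _ (\sum_(r < n) 4)); last first.
  by rewrite sumr_const card_ord mulr_natr.
apply: ler_sum => -[r rn] _ /=.
rewrite (@texp r.+1) // mulrA -/(z r.+1).
have [zb _] := @z_bound r.+1 rn.
apply: le_trans zb; rewrite ler_piMr ?exprn_ile1 //.
by rewrite mulr_ge0 // exprn_ge0.
Qed.

(** Here c plays the part of the number of involutions and a of those of alternating type. By
    [sum_bound], a contributes at most (1 + q^6) t^(n-1) 4n after normalisation. *)
Lemma count_approx (a c : nat) :
  (\sum_(r < n.+1 | ~~ odd r) x r <= c <= \sum_(r < n.+1 | ~~ odd r) x r + a)%N ->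
  (a * q ^ n.-1 <= (1 + q ^ 6) * \sum_(r < n) x r.+1)%N ->
  `|c%:R * t ^+ (n ^ 2)%N -
    \sum_(r < n.+1 | ~~ odd r) t ^+ ((n - r) ^ 2)%N * gauss n (n - r)|
   <= (6 + 4 * q%:R * (1 + q%:R ^+ 6)) * n.+1%:R * t ^+ n.
Proof.
set K := (\sum_(r < _ | _) _)%N => /andP[Kc cK] aX.
have tn0 k : 0 <= t ^+ k by rewrite exprn_ge0.
have ab : a%:R * t ^+ (n ^ 2)%N <= 4 * q%:R * (1 + q%:R ^+ 6) * n.+1%:R * t ^+ n.
  have e1 : t ^+ n.-1 = q%:R * t ^+ n.
    by rewrite -[in RHS](prednK n_gt0) exprS mulrA mulfV // mul1r.
  have : a%:R * q%:R ^+ n.-1 <= (1 + q%:R ^+ 6) * (\sum_(r < n) x r.+1)%N%:R :> R.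
    by rewrite -!natrX -natrM -(natrD _ 1) -natrM ler_nat.
  move/(ler_wpM2r (mulr_ge0 (tn0 n.-1) (tn0 (n ^ 2)%N))).
  have -> : a%:R * q%:R ^+ n.-1 * (t ^+ n.-1 * t ^+ (n ^ 2)) = a%:R * t ^+ (n ^ 2)%N.
    by rewrite mulrA -(mulrA a%:R) (mulrC (q%:R ^+ _)) tq mulr1.
  move/le_trans; apply.
  have -> : (1 + q%:R ^+ 6) * (\sum_(r < n) x r.+1)%N%:R * (t ^+ n.-1 * t ^+ (n ^ 2)%N)
    = (1 + q%:R ^+ 6) * q%:R * t ^+ n * ((\sum_(r < n) x r.+1)%N%:R * t ^+ (n ^ 2)%N).
    by rewrite e1; ring.
  have -> : 4 * q%:R * (1 + q%:R ^+ 6) * n.+1%:R * t ^+ n =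
    (1 + q%:R ^+ 6) * q%:R * t ^+ n * (4 * n.+1%:R) by ring.
  apply: ler_wpM2l.
    by rewrite !mulr_ge0 // ?addr_ge0 ?exprn_ge0 // ltW.
  by apply: le_trans sum_bound _; rewrite ler_wpM2l // ler_nat.
have := sum_approx; rewrite -/K; set S := \sum_(r < _ | _) _.
set y := 4 * _ * _ in ab *.
have T : c%:R * t ^+ (n ^ 2)%N - S = (K%:R * t ^+ (n ^ 2)%N - S) + (c - K)%N%:R * t ^+ (n ^ 2)%N.
  by rewrite natrB //; ring.
have cKa : (c - K)%N%:R * t ^+ (n ^ 2)%N <= a%:R * t ^+ (n ^ 2)%N.
  by rewrite ler_wpM2r // ler_nat leq_subLR.
have cK0 : 0 <= (c - K)%N%:R * t ^+ (n ^ 2)%N by rewrite mulr_ge0.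
move=> SA; rewrite T; apply: le_trans (ler_normD _ _) _.
rewrite (ger0_norm cK0) (mulrDl 6 y) mulrDl; exact: lerD SA (le_trans cKa ab).
Qed.
End Asymptotics.

(** With j = n - r, the condition that r be even has indicator (1 + (-1)^(n+j)) / 2. *)
Lemma parity_sum n (f : nat -> R) :
  \sum_(r < n.+1 | ~~ odd r) f (n - r)%N =
  2^-1 * (\sum_(j < n.+1) f j + (-1) ^+ n * \sum_(j < n.+1) (-1) ^+ j * f j).
Proof.
rewrite mulr_sumr -big_split mulr_sumr /= (reindex_inj rev_ord_inj) /=.
rewrite big_mkcond /=; apply: eq_bigr => -[r rn] _ /=; rewrite subSS.
have rn' : (r <= n)%N by [].
rewrite subKn // mulrA -exprD -signr_odd oddB // oddD addbC.
by case: (odd r (+) odd n) => /=; rewrite ?expr0 ?expr1; field.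
Qed.
End Estimates.

Local Open Scope classical_set_scope.

(** * Convergence of the infinite products and of the error term *)

Section Products.
Variables (R : realType) (q : nat).
Hypothesis q_gt1 : (1 < q)%N.
Local Notation t := (q%:R^-1 : R).

Let t_gt0 : 0 < t. Proof. by rewrite invr_gt0 ltr0n; lia. Qed.
Let t_half : t <= 2^-1.
Proof. by rewrite lef_pV2 ?posrE // ?ler_nat // ltr0n; lia. Qed.
Let t_ge0 : 0 <= t. Proof. exact: ltW. Qed.
Let t_le1 : t <= 1. Proof. by apply: (le_trans t_half); lra. Qed.

Let texp_half k : 0 < t ^+ k.+1 <= 2^-1.
Proof.
rewrite exprn_gt0 //= exprS; apply: le_trans t_half.
by rewrite ler_piMr // exprn_ile1.
Qed.

Lemma cvg_prod_plus :
  (fun n => \prod_(1 <= i < n.+1) (1 + t ^+ (2 * i - 1)) : R) @ \oo -->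
  infinite_prod (fun i => 1 + 1 / q%:R ^+ (2 * i - 1) : R).
Proof.
set u := fun n : nat => _.
have -> : infinite_prod (fun i => 1 + 1 / q%:R ^+ (2 * i - 1) : R) = limn u.
  rewrite /infinite_prod; congr (lim _); congr (_ @ \oo); apply/funext => n.
  by apply: eq_bigr => i _; rewrite div1r exprVn.
have uS n : u n.+1 = u n * (1 + t ^+ (2 * n.+1 - 1)) by rewrite /u big_nat_recr.
have pos n : 0 < u n.
  by apply: prodr_gt0 => i _; rewrite ltr_wpDr ?exprn_ge0.
apply: nondecreasing_is_cvgn.
  apply/nondecreasing_seqP => n; rewrite uS ler_peMr //; first exact: ltW.
  by rewrite lerDl exprn_ge0.
exists 3 => _ [n _ <-]; case: n => [|n].
  by rewrite /u big_geq //; lra.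
(* The bound 3 alone is not inductive. The base case 1 + t <= 3(1 - t) amounts to t <= 1/2. *)
suff : u n.+1 <= 3 * (1 - t ^+ n.+1).
  by move/le_trans; apply; have := texp_half n; lra.
elim: n => [|n IH].
  rewrite uS /u big_geq // mul1r muln1 subn1 /= !expr1. move: t_half; move: (t) => s; lra.
rewrite uS; have -> : (2 * n.+2 - 1 = n.+1 + n.+2)%N by lia.
rewrite exprD (exprS _ n.+1); have /andP[] := texp_half n.
move: IH (pos n.+1); move: (t ^+ n.+1) (u n.+1) => a v.
move: t_gt0 t_half; move: (t) => s s0 s1 IH v0 a0 a1.
apply: (@le_trans _ _ (3 * (1 - a) * (1 + a * (s * a)))).
  by rewrite ler_wpM2r // addr_ge0 // !mulr_ge0 // ltW.
have sa : s * a * a <= (1 - s) * a.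
  by rewrite ler_wpM2r ?ltW //; nra.
have : 0 <= s * a * a * a by rewrite !mulr_ge0 // ltW.
by nra.
Qed.

Lemma cvg_prod_minus :
  (fun n => \prod_(1 <= i < n.+1) (1 - t ^+ (2 * i - 1)) : R) @ \oo -->
  infinite_prod (fun i => 1 - 1 / q%:R ^+ (2 * i - 1) : R).
Proof.
set u := fun n : nat => _.
have -> : infinite_prod (fun i => 1 - 1 / q%:R ^+ (2 * i - 1) : R) = limn u.
  rewrite /infinite_prod; congr (lim _); congr (_ @ \oo); apply/funext => n.
  by apply: eq_bigr => i _; rewrite div1r exprVn.
have pos n : 0 <= u n.
  by apply: prodr_ge0 => i _; rewrite subr_ge0 exprn_ile1.
apply: nonincreasing_is_cvgn; last by exists 0 => _ [n _ <-].
apply/nonincreasing_seqP => n; rewrite [u n.+1]big_nat_recr //= ler_piMr //.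
exact: pos.
Qed.

Lemma cvg_error (C : R) : (fun n => C * n.+1%:R * t ^+ n) @ \oo --> 0.
Proof.
(* Combines t <= 1/2 with n + 1 <= 2 (3/2)^n. *)
have bern n : n.+1%:R * t ^+ n <= 2 * (3 / 4) ^+ n :> R.
  apply: (@le_trans _ _ (n.+1%:R * 2^-1 ^+ n)).
    by rewrite ler_wpM2l // lerXn2r ?nnegrE // invr_ge0.
  have -> : (3 / 4 : R) = 3 / 2 * 2^-1 by field.
  rewrite exprMn mulrA ler_wpM2r ?exprn_ge0 ?invr_ge0 //.
  elim: n => [|n IH]; first by rewrite expr0 mulr1 ler_nat.
  have : 1 <= (3 / 2 : R) ^+ n by rewrite exprn_ege1 //; lra.
  rewrite exprS -[n.+2%:R]natr1; lra.
apply: norm_cvg0.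
apply: (@squeeze_cvgr _ _ _ _ (fun=> 0) (fun n => geometric (`|C| * 2) (3 / 4) n)).
- near=> n; rewrite normr_ge0 /= !normrM -!mulrA ler_wpM2l //.
  rewrite !ger0_norm ?exprn_ge0 //.
- exact: cvg_cst.
- by apply: cvg_geometric; rewrite ger0_norm; lra.
Unshelve. all: by end_near.
Qed.

End Products.

(** * Non-defectiveness of the given forms, and the limits *)

Lemma polar_plus_form (F : fieldType) (n : nat) (u v : 'rV[F]_(n + n)) :
  polar_form (@plus_form F n) u v =
  \sum_(i < n) (u 0 (lshift n i) * v 0 (rshift n i) + u 0 (rshift n i) * v 0 (lshift n i)).
Proof.
rewrite /polar_form /plus_form -!sumrB; apply: eq_bigr => i _.
by rewrite !mxE; ring.
Qed.

Lemma plus_form_quadratic (F : fieldType) (n : nat) :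
  is_quadratic_form (@plus_form F n).
Proof.
split=> [a v|u a v w|v a u w].
- rewrite /plus_form mulr_sumr; apply: eq_bigr => i _; rewrite !mxE; ring.
- rewrite !polar_plus_form mulr_sumr -big_split; apply: eq_bigr => i _.
  by rewrite !mxE /=; ring.
- rewrite !polar_plus_form mulr_sumr -big_split; apply: eq_bigr => i _.
  by rewrite !mxE /=; ring.
Qed.

Lemma plus_form_non_defective (F : fieldType) (n : nat) :
  non_defective (@plus_form F n).
Proof.
move=> u h; apply/rowP => j; rewrite [RHS]mxE.
case: (split_ordP j) => i ->.
  have := h (delta_mx 0 (rshift n i)); rewrite polar_plus_form (bigD1 i) //= big1.
    by rewrite !mxE !eqxx eq_lrshift /= mulr1 mulr0 !addr0.
  move=> k ki; rewrite !mxE eq_lrshift eq_rshift /= (negPf ki) !mulr0 addr0 //.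
have := h (delta_mx 0 (lshift n i)); rewrite polar_plus_form (bigD1 i) //= big1.
  by rewrite !mxE !eqxx eq_rlshift /= mulr1 mulr0 add0r addr0.
by move=> k ki; rewrite !mxE eq_rlshift eq_lshift /= (negPf ki) !mulr0 addr0.
Qed.

Lemma form_of_signP (F : fieldType) (s : bool) (n : nat) (Q : 'rV[F]_(n + n) -> F) :
  form_of_sign s Q -> is_quadratic_form Q /\ non_defective Q.
Proof.
case: s => [QE|[]//]; have -> : Q = @plus_form F n by exact/funext.
by split; [exact: plus_form_quadratic|exact: plus_form_non_defective].
Qed.

(** One estimate covers both signs and both parities of n: the sign of the form enters only through
    the choice of sign in [card_nonalt_invols1_dim], which the error absorbs, and the parity through
    (-1)^n. *)
Lemma involution_count_approx (R : realType) (F : finFieldType) (n : nat)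
    (Q : 'rV[F]_(n + n) -> F) (q := #|F|) (t := q%:R^-1 : R) :
  2%N \in [pchar F] -> is_quadratic_form Q -> non_defective Q -> (2 < n)%N ->
  `|(num_involutions (Omega Q))%:R / q%:R ^+ (n ^ 2)%N -
    2^-1 * (\prod_(1 <= i < n.+1) (1 + t ^+ (2 * i - 1))
            + (-1) ^+ n * \prod_(1 <= i < n.+1) (1 - t ^+ (2 * i - 1)))|
   <= (6 + 4 * q%:R * (1 + q%:R ^+ 6)) * n.+1%:R * t ^+ n.
Proof.
move=> F2 Qq Qnd n2; have q1 : (1 < q)%N := finNzRing_gt1 F.
have n0 : (0 < n)%N by apply: leq_trans n2.
have x0 : #|nonalt_invols Q 0| = 0%N.
  apply/eqP; rewrite cards_eq0; apply/eqP/setP => M; rewrite !inE mxrank_eq0.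
  apply/negP => /and3P[_ /existsP[v Qv] /eqP M0]; case/eqP: Qv.
  by rewrite M0 mulmx0 (quad0 Qq).
have xS r : (0 < r < n)%N ->
    (#|nonalt_invols Q r.+1| * (q ^ r - odd r.+1) =
     #|nonalt_invols Q r| * (q ^ (n + n - r).-1 - q ^ r.-1))%N.
  by case/andP=> r0 _; exact: card_nonalt_invols_rec.
have := @count_approx R q q1 n (fun r => #|nonalt_invols Q r|) n0 x0
  (card_nonalt_invols1_dim F2 Qq Qnd erefl) xS _ _
  (num_involutions_bounds F2 Qq Qnd erefl n2) (card_alt_invols_all_le F2 Qq Qnd erefl n0).
rewrite (@parity_sum R n (fun j => t ^+ (j ^ 2)%N * gauss R q n j)).
have -> : \prod_(1 <= i < n.+1) (1 + t ^+ (2 * i - 1)) =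
    \sum_(j < n.+1) t ^+ (j ^ 2)%N * gauss R q n j.
  have := euler_finite q1 (1 : R) n; under eq_bigr do rewrite mul1r.
  by move=> ->; apply: eq_bigr => j _; rewrite expr1n mul1r.
have -> : \prod_(1 <= i < n.+1) (1 - t ^+ (2 * i - 1)) =
    \sum_(j < n.+1) (-1) ^+ j * (t ^+ (j ^ 2)%N * gauss R q n j).
  have := euler_finite q1 (-1 : R) n; under eq_bigr do rewrite mulN1r.
  by rewrite -/t => ->; apply: eq_bigr => j _; rewrite -mulrA.
by rewrite exprVn.
Qed.

Theorem theorem7p6 (R : realType) (q : nat) (hq : exists k : nat, q = (2 ^ k)%N)
    (F : finFieldType) (hF : #|F| = q) (s : bool)
    (Q : forall n : nat, 'rV[F]_(n + n) -> F)
    (hQ : forall n : nat, (0 < n)%N -> form_of_sign s (Q n)) :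
  ((fun m : nat => (num_involutions (Omega (Q (2 * m)%N)))%:R
                     / q%:R ^+ ((2 * m) ^ 2)%N : R) @ \oo
     --> 2^-1 * (infinite_prod (fun i : nat => 1 + 1 / q%:R ^+ (2 * i - 1)%N)
               + infinite_prod (fun i : nat => 1 - 1 / q%:R ^+ (2 * i - 1)%N)))
  /\
  ((fun m : nat => (num_involutions (Omega (Q (2 * m + 1)%N)))%:R
                     / q%:R ^+ ((2 * m + 1) ^ 2)%N : R) @ \oo
     --> 2^-1 * (infinite_prod (fun i : nat => 1 + 1 / q%:R ^+ (2 * i - 1)%N)
               - infinite_prod (fun i : nat => 1 - 1 / q%:R ^+ (2 * i - 1)%N))).
Proof.
have F2 : 2%N \in [pchar F] by case: hq => k qk; rewrite (@card_finPcharP _ 2 k) ?hF.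
have q1 : (1 < q)%N by rewrite -hF; exact: finNzRing_gt1.
set Pp := infinite_prod _; set Pm := infinite_prod _.
pose u n : R := (num_involutions (Omega (Q n)))%:R / q%:R ^+ (n ^ 2)%N.
pose a n : R := \prod_(1 <= i < n.+1) (1 + q%:R^-1 ^+ (2 * i - 1)).
pose b n : R := \prod_(1 <= i < n.+1) (1 - q%:R^-1 ^+ (2 * i - 1)).
have du : (fun n => u n - 2^-1 * (a n + (-1) ^+ n * b n)) @ \oo --> (0 : R).
  apply: norm_cvg0.
  apply: (@squeeze_cvgr _ _ _ _ (fun=> 0)
    (fun n => (6 + 4 * q%:R * (1 + q%:R ^+ 6)) * n.+1%:R * q%:R^-1 ^+ n)).
  - near=> n; rewrite normr_ge0 /=.
    have n2 : (2 < n)%N by near: n; exact: nbhs_infty_gt.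
    have [Qq Qnd] := form_of_signP (hQ n (ltn_trans (isT : 0 < 2)%N n2)).
    by have := @involution_count_approx R F n (Q n) F2 Qq Qnd n2; rewrite hF.
  - exact: cvg_cst.
  - exact: cvg_error.
(* Along dimensions f m of constant parity the sign (-1)^(f m) is a constant e, and the estimate
   passes to the limit. *)
have lim_sub (f : nat -> nat) (e : R) : f @ \oo --> \oo ->
    (forall m, (-1) ^+ f m = e) -> (fun m => u (f m)) @ \oo --> 2^-1 * (Pp + e * Pm).
  move=> fy fe.
  have ca : (fun m => a (f m)) @ \oo --> Pp := cvg_comp _ _ fy (@cvg_prod_plus R q q1).
  have cb : (fun m => b (f m)) @ \oo --> Pm := cvg_comp _ _ fy (@cvg_prod_minus R q q1).
  have cd := cvg_comp _ _ fy du.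
  rewrite -[X in _ --> X]add0r.
  have -> : (fun m => u (f m)) =
      (fun m => u (f m) - 2^-1 * (a (f m) + (-1) ^+ f m * b (f m))
                + 2^-1 * (a (f m) + e * b (f m))).
    by apply/funext => m; rewrite fe subrK.
  apply: cvgD; first exact: cd.
  by apply: cvgM; [exact: cvg_cst|apply: cvgD => //; apply: cvgM => //; exact: cvg_cst].
split.
- rewrite -[X in _ * (_ + X)]mul1r; apply: (@lim_sub (fun m => (2 * m)%N)).
    exact: cvg_mulnl.
  by move=> m; rewrite mulnC exprM sqrr_sign.
- rewrite -[X in _ * (_ + X)]mulN1r; apply: (@lim_sub (fun m => (2 * m + 1)%N)).
    exact: (cvg_comp _ _ (@cvg_mulnl 2 isT) (cvg_addnr 1)).
  by move=> m; rewrite exprD mulnC exprM sqrr_sign mul1r expr1.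
Unshelve. all: by end_near.
Qed.
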